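(* Let $R$ be a commutative domain of finite character with field of fractions $Q$. Let $\Lambda$ be an $R$-algebra that is finitely generated as an $R$-module and such that $\Lambda\otimes_R Q$ is a simple artinian ring. Let $M=\bigoplus_{i\in\mathbb N_0}A_i$ and $N=\bigoplus_{i\in\mathbb N_0}B_i$ be direct sums of non-zero finitely generated right $\Lambda$-modules which are torsion-free as $R$-modules. If $M$ and $N$ are in the same genus, then there are decompositions $M=\bigoplus_{i\in\mathbb N_0}M_i$ and $N=\bigoplus_{i\in\mathbb N_0}N_i$ with each $M_i$, $N_i$ finitely generated and $M_i\cong N_i$ for every $i$. In particular $M\cong N$.
   Context: A commutative domain has finite character if every non-zero element lies in only finitely many maximal ideals. A module $M$ is torsion-free over $R$ if $M\to M\otimes_R Q$ is injective. Two right $\Lambda$-modules $M,N$ are in the same genus if $M_\mathfrak m\cong N_\mathfrak m$ as $\Lambda_\mathfrak m$-modules for every maximal ideal $\mathfrak m$ of $R$ (localization at $R\setminus\mathfrak m$). *)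

(* Defs.v *)
From HB Require Import structures.
From mathcomp Require Import all_boot all_order all_algebra.
Set Implicit Arguments. Unset Strict Implicit. Unset Printing Implicit Defensive.
Import Order.TTheory GRing.Theory.
Local Open Scope ring_scope.

Definition ideal (R : comNzRingType) (I : R -> Prop) : Prop :=
  [/\ I 0, (forall x y, I x -> I y -> I (x - y)) & (forall r x, I x -> I (r * x))].

Definition maximal_ideal (R : comNzRingType) (I : R -> Prop) : Prop :=
  [/\ ideal I, ~ I 1 &
      (forall J : R -> Prop, ideal J -> (forall x, I x -> J x) ->
         (forall x, J x <-> I x) \/ (forall x, J x))].

Definition finite_character (R : idomainType) : Prop :=
  forall x : R, x != 0 ->
    exists (n : nat) (m : nat -> R -> Prop),
      forall I, maximal_ideal I -> I x ->
        exists2 i, (i < n)%N & forall y, I y <-> m i y.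

(* Right Lambda-modules are left modules over the converse ring Lambda^c. *)
Definition ract (R : comNzRingType) (L : algType R) (M : lmodType L^c)
  (m : M) (a : L) : M := (a : L^c) *: m.

Definition alg_fin_gen (R : comNzRingType) (L : algType R) : Prop :=
  exists (n : nat) (g : nat -> L),
    forall a : L, exists c : nat -> R, a = \sum_(j < n) c j *: g j.

Section Modules.
Variables (R : comNzRingType) (L : algType R).

Definition rlinear (M N : lmodType L^c) (f : M -> N) : Prop :=
  (forall x y, f (x + y) = f x + f y) /\ (forall x a, f (ract x a) = ract (f x) a).

Definition mod_fin_gen (M : lmodType L^c) : Prop :=
  exists (n : nat) (g : nat -> M),
    forall x : M, exists c : nat -> L, x = \sum_(j < n) ract (g j) (c j).

Definition submodule (M : lmodType L^c) (P : M -> Prop) : Prop :=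
  [/\ P 0, (forall x y, P x -> P y -> P (x - y)) & (forall x a, P x -> P (ract x a))].

Definition sub_fin_gen (M : lmodType L^c) (P : M -> Prop) : Prop :=
  exists (n : nat) (g : nat -> M), (forall j, (j < n)%N -> P (g j)) /\
    forall x, P x -> exists c : nat -> L, x = \sum_(j < n) ract (g j) (c j).

Definition is_direct_sum (M : lmodType L^c) (P : nat -> M -> Prop) : Prop :=
  [/\ (forall i, submodule (P i)),
      (forall x, exists (n : nat) (v : nat -> M),
          (forall i, P i (v i)) /\ x = \sum_(i < n) v i) &
      (forall (n : nat) (v : nat -> M), (forall i, P i (v i)) ->
          \sum_(i < n) v i = 0 -> forall i, (i < n)%N -> v i = 0)].

Definition is_direct_sum_of (M : lmodType L^c) (A : nat -> lmodType L^c)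
  (e : forall i, A i -> M) : Prop :=
  (forall i, rlinear (e i) /\ injective (e i)) /\
  is_direct_sum (fun i x => exists a, e i a = x).

Definition sub_iso (M N : lmodType L^c) (P : M -> Prop) (Q : N -> Prop) : Prop :=
  exists f : M -> N,
    [/\ (forall x y, P x -> P y -> f (x + y) = f x + f y),
        (forall x a, P x -> f (ract x a) = ract (f x) a),
        (forall x, P x -> Q (f x)),
        (forall x y, P x -> P y -> f x = f y -> x = y) &
        (forall y, Q y -> exists2 x, P x & f x = y)].

Definition mod_iso (M N : lmodType L^c) : Prop :=
  exists f : M -> N, rlinear f /\ bijective f.

(* Localization of a right Lambda-module at a multiplicative subset S of R,
   characterized (up to isomorphism) by its standard concrete description:
   phi : M -> L is Lambda-linear, elements of S act bijectively on L,
   ker phi = {x | x s = 0 for some s in S}, and every y in L is phi x / s. *)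
Definition is_localization (S : R -> Prop) (M Ml : lmodType L^c) (phi : M -> Ml)
  : Prop :=
  [/\ rlinear phi,
      (forall s, S s -> bijective (fun y : Ml => ract y (s%:A))),
      (forall x, phi x = 0 <-> exists2 s, S s & ract x (s%:A) = 0) &
      (forall y : Ml, exists x s, S s /\ ract y (s%:A) = phi x)].

(* Torsion-free over R: M -> M (x)_R Q = (R\{0})^{-1} M is injective *)
Definition torsion_free (M : lmodType L^c) : Prop :=
  exists (Mq : lmodType L^c) (phi : M -> Mq),
    is_localization (fun s => s <> 0) phi /\ injective phi.

(* Same genus: M_m ~= N_m as Lambda_m-modules for every maximal ideal m.
   A Lambda_m-linear map between Lambda_m-modules is the same as a
   Lambda-linear map. *)
Definition same_genus (M N : lmodType L^c) : Prop :=
  forall m : R -> Prop, maximal_ideal m ->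
    exists (Mm Nm : lmodType L^c) (phi : M -> Mm) (psi : N -> Nm) (f : Mm -> Nm),
      [/\ is_localization (fun s => ~ m s) phi,
          is_localization (fun s => ~ m s) psi,
          rlinear f & bijective f].

End Modules.

Definition right_ideal (T : nzRingType) (I : T -> Prop) : Prop :=
  [/\ I 0, (forall x y, I x -> I y -> I (x - y)) & (forall x t, I x -> I (x * t))].

Definition two_sided_ideal (T : nzRingType) (I : T -> Prop) : Prop :=
  right_ideal I /\ (forall x t, I x -> I (t * x)).

Definition right_artinian (T : nzRingType) : Prop :=
  forall I : nat -> T -> Prop, (forall n, right_ideal (I n)) ->
    (forall n x, I n.+1 x -> I n x) ->
    exists n, forall k, (n <= k)%N -> forall x, I k x <-> I n x.

Definition simple_ring (T : nzRingType) : Prop :=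
  forall J : T -> Prop, two_sided_ideal J ->
    (forall x, J x <-> x = 0) \/ (forall x, J x).

Definition simple_artinian (T : nzRingType) : Prop :=
  simple_ring T /\ right_artinian T.

(* Lambda (x)_R Q, realized as the localization (R\{0})^{-1} Lambda,
   characterized up to isomorphism; we ask it to be simple artinian. *)
Definition tensorQ_simple_artinian (R : idomainType) (L : algType R) : Prop :=
  exists (T : nzRingType) (iota : L -> T),
    [/\ [/\ (forall a b, iota (a + b) = iota a + iota b),
            (forall a b, iota (a * b) = iota a * iota b) & iota 1 = 1],
        (forall s : R, s != 0 -> exists u : T,
            u * iota (s%:A) = 1 /\ iota (s%:A) * u = 1),
        (forall a, iota a = 0 <-> exists2 s : R, s != 0 & s *: a = 0),
        (forall t : T, exists (a : L) (s : R), s != 0 /\ t * iota (s%:A) = iota a) &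
        simple_artinian T].

(* Main.v *)
Require Import Defs.
From HB Require Import structures.
From mathcomp Require Import all_boot all_order all_algebra.
From mathcomp Require Import ring boolp classical_sets ring_quotient.
Set Implicit Arguments. Unset Strict Implicit. Unset Printing Implicit Defensive.
Import GRing.Theory.
Local Open Scope ring_scope.

(** Everything takes place in the endomorphism ring of [Z = M * N], with localizations
    replaced by identities holding up to a scalar outside the maximal ideal.

    A finitely generated summand [C] of [M] splits off a finite part of [N] as soon as it does
    so locally.  As [L (x) Q] is simple artinian, [C] can be mapped to a block of [N] and
    back with composite a nonzero scalar [r0]; by finite character only finitely many maximal
    ideals contain [r0], so some larger finite part [Y] of [N] splits off [C] at every
    maximal ideal.  Repeat this in a block disjoint from [Y], with composite [r2], and
    add a map to [Y] that splits at the finitely many maximal ideals containing [r2]: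
    the sum splits everywhere, hence globally.

    After finitely many steps of a back-and-forth one has isomorphic summands [P] of [M] and
    [Q] of [N], and has to split [C] off a complement of [Q], given that [P + C] locally
    splits off [N].  This is Evans cancellation: the endomorphism ring of a module
    finitely generated over a local ring has stable range one, because it maps to an algebra
    of matrices over the residue field and this map reflects units (Cayley-Hamilton). *)

(** * Maximal ideals and residue fields *)

(** Local maps glue only over finitely many maximal ideals at once. This is why nonzero scalars are
    collected: a composite equal to [r] is already a splitting at each maximal ideal that omits [r].
    The tail always supplies such scalars, because every summand has nonzero functionals with values
    in the simple ring [L (x) Q], and finitely many of these values, taken from different summands,
    add up to 1.

    Idempotents need not lift from the residue algebra to the local endomorphism ring, so nothing is
    decomposed locally. Instead one element is found over the residue field and lifted arbitrarily;
    it gives a unipotent change of the embedding, after which the known summand can be eliminated as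
    by a pivot. Stable range one over the residue field rests on Fitting decompositions: their
    projections are polynomials in one element, so they stay in the subalgebra.

    In the single ring of endomorphisms of [Z], summands are idempotents, maps between them are
    elements of corners, and every claim becomes an identity of products. *)

Section Ideals.
Variable R : comNzRingType.
Implicit Types (I J m : R -> Prop).

Lemma idealD I x y : ideal I -> I x -> I y -> I (x + y).
Proof.
case=> I0 IB _ Ix Iy; rewrite -[y]opprK; apply: (IB) => //.
by rewrite -sub0r; apply: IB.
Qed.

Lemma exists_maximal_ideal J : ideal J -> ~ J 1 ->
  exists2 m, maximal_ideal m & forall x, J x -> m x.
Proof.
move=> JI J1.
pose P := fun A : set R => A = (fun _ => False) \/ [/\ ideal A, ~ A 1 & forall x, J x -> A x].
have [F FP Ftot|A [PA Amax]] := @Zorn_bigcup R P.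
  case: (pselect (exists2 X, F X & exists x, X x)) => [[X0 FX0 X0n]|none]; last first.
    left; apply/funext => x; apply/propext; split=> // -[X FX Xx].
    by apply: none; exists X => //; exists x.
  have FI X x : F X -> X x -> [/\ ideal X, ~ X 1 & forall x, J x -> X x].
    by move=> FX Xx; case: (FP _ FX) => // XE; rewrite XE in Xx.
  right; case: X0n => x0 X0x0; have [X0I X01 JX0] := FI _ _ FX0 X0x0.
  split.
  - split.
    + by exists X0 => //; case: X0I.
    + move=> x y [X FX Xx] [Y FY Yy].
      have [XI _ _] := FI _ _ FX Xx; have [YI _ _] := FI _ _ FY Yy.
      case: (Ftot _ _ FX FY) => sub.
        by exists Y => //; case: YI => _ YB _; apply: YB => //; apply: sub.
      by exists X => //; case: XI => _ XB _; apply: XB => //; apply: sub.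
    + by move=> r x [X FX Xx]; exists X => //; have [[_ _ XM] _ _] := FI _ _ FX Xx; apply: XM.
  - by move=> [X FX X1]; case: (FI _ _ FX X1).
  - by move=> x Jx; exists X0 => //; apply: JX0.
have maxE B : ideal B -> ~ B 1 -> (forall x, J x -> B x) -> (forall x, A x -> B x) ->
    forall x, B x -> A x.
  move=> BI B1 JB AB x Bx; apply: contrapT => nAx; apply: (Amax B); last by right.
  by split=> // BA; apply/nAx/BA.
have [AI A1 JA] : [/\ ideal A, ~ A 1 & forall x, J x -> A x].
  case: PA => // AE; have [J0 _ _] := JI.
  by have := maxE _ JI J1 (fun x h => h); rewrite AE => /(_ (fun x => @False_ind _) 0 J0).
exists A => //; split=> // K KI AK.
case: (pselect (K 1)) => K1.
  by right=> x; rewrite -[x]mulr1; case: KI => _ _; apply.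
left=> x; split; last exact: AK.
by apply: maxE => // y Jy; apply/AK/JA.
Qed.

Lemma maximal_ideal_inv m x : maximal_ideal m -> ~ m x -> exists y, m (1 - y * x).
Proof.
move=> [[m0 mB mM] m1 mmax] nmx.
pose K := fun z => exists y, m (z - y * x).
have KI : ideal K.
  split; first by exists 0; rewrite mul0r subrr.
  - move=> a b [y ya] [z zb]; exists (y - z).
    by have := mB _ _ ya zb; have -> : a - y * x - (b - z * x) = a - b - (y - z) * x by ring.
  - by move=> r a [y ya]; exists (r * y); rewrite -mulrA -mulrBr; apply: mM.
have [|KE|KE] := mmax _ KI; last exact: KE.
  by move=> y my; exists 0; rewrite mul0r subr0.
case: nmx; apply/KE; exists 1; by rewrite mul1r subrr.
Qed.

Lemma maximal_ideal_prime m x y : maximal_ideal m -> m (x * y) -> m x \/ m y.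
Proof.
move=> mm mxy; case: (pselect (m x)) => [|nx]; [by left | right].
have [z mz] := maximal_ideal_inv mm nx.
have [[_ _ mM] _ _] := mm; have mI : ideal m by case: mm.
have -> : y = y * (1 - z * x) + z * (x * y).
  by rewrite mulrBr mulr1 mulrA [y * _]mulrC subrK.
by apply: idealD => //; apply: mM.
Qed.

Section Residue.
Variables (m : R -> Prop) (mm : maximal_ideal m).
Local Open Scope quotient_scope.
(** The maximality proof is carried as an argument so that the ideal structure, and with it the
    field structure of the quotient, can be inferred from the predicate alone. *)
Definition maxpred of maximal_ideal m : {pred R} := fun x => `[< m x >].
Local Notation mp := (maxpred mm).

Lemma maxpred_idealr_closed : idealr_closed mp.
Proof.
have [[m0 mB mM] m1 _] := mm; split; first exact/asboolP.
  by apply/asboolP.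
move=> a x y /asboolP mx /asboolP my; apply/asboolP.
by apply: idealD; [case: mm | apply: mM |].
Qed.

HB.instance Definition _ := isIdealr.Build R mp maxpred_idealr_closed.

Lemma pi_residue_eq0 x : (\pi_{ideal_quot mp} x == 0) = `[< m x >].
Proof.
rewrite -[X in _ == X](rmorph0 \pi_{ideal_quot mp}) -Quotient.idealrBE subr0.
by [].
Qed.

Lemma residue_mulVf : exists inv : {ideal_quot mp} -> {ideal_quot mp},
  (forall x, x != 0 -> inv x * x = 1) /\ inv 0 = 0.
Proof.
have h (x : {ideal_quot mp}) : exists y, (x != 0 -> y * x = 1) /\ (x = 0 -> y = 0).
  case: (eqVneq x 0) => [->|xn0]; first by exists 0.
  rewrite -[x]reprK in xn0 *; move: (repr x) xn0 => r rn0.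
  have [|y my] := @maximal_ideal_inv m r mm.
    by move=> /asboolP; rewrite -pi_residue_eq0; apply/negP.
  exists (\pi y); split=> [_|/eqP]; last by rewrite (negPf rn0).
  apply/eqP; rewrite -rmorphM -[X in _ == X](rmorph1 \pi_{ideal_quot mp}) -subr_eq0 -rmorphB.
  by rewrite -oppr_eq0 -rmorphN opprB pi_residue_eq0; apply/asboolP.
have [inv invP] := choice h.
by exists inv; split=> [x|]; [apply: (invP x).1 | apply: (invP 0).2].
Qed.

HB.instance Definition _ := GRing.ComNzRing_isField.Build {ideal_quot mp}
  (svalP (cid residue_mulVf)).1 (svalP (cid residue_mulVf)).2.

Lemma exists_residue_field : exists (k : fieldType) (f : {rmorphism R -> k}),
  (forall x, f x = 0 <-> m x) /\ forall y, exists x, f x = y.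
Proof.
exists {ideal_quot mp}, \pi_{ideal_quot mp}; split=> [x|y].
  split=> [/eqP|mx]; first by rewrite pi_residue_eq0 => /asboolP.
  by apply/eqP; rewrite pi_residue_eq0; apply/asboolP.
by exists (repr y); apply: (reprK y).
Qed.
End Residue.
End Ideals.

(** * Simple artinian rings *)

Section SimpleArtinian.
Variable T : nzRingType.
Implicit Types (e x : T) (I K S W : T -> Prop).

(** Without a minimal member, choice would iterate strict descents into a chain that never
    stabilises. *)
Lemma artinian_min (F : (T -> Prop) -> Prop) :
  right_artinian T -> (forall K, F K -> right_ideal K) -> (exists K, F K) ->
  exists2 K, F K & forall K', F K' -> (forall x, K' x -> K x) -> forall x, K x -> K' x.
Proof.
move=> art FI [K0 FK0]; apply: contrapT => noMin.
have next (K : {K | F K}) :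
    exists K' : {K | F K}, (forall x, sval K' x -> sval K x) /\
      ~ (forall x, sval K x -> sval K' x).
  case: K => K FK /=; apply: contrapT => nex; apply: noMin.
  exists K => // K' FK' sub; apply: contrapT => nsub.
  by apply: nex; exists (exist _ K' FK').
have [g gP] := choice next.
pose c n := iter n g (exist _ K0 FK0).
have [n nP] := art (fun n => sval (c n)) (fun n => FI _ (svalP (c n)))
  (fun n => (gP (c n)).1).
case: (gP (c n)) => _ []; move=> x xc.
by have /(_ x) [_ h] := nP n.+1 (leqnSn n); apply: h.
Qed.

(** The right annihilator of a right ideal is two-sided, and it omits 1 when the ideal is nonzero;
    simplicity makes it zero. *)
Lemma right_ideal_prime S (x : T) : simple_ring T -> right_ideal S ->
  (exists2 s, S s & s <> 0) -> x <> 0 -> exists2 s, S s & s * x <> 0.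
Proof.
move=> simp [S0 SB SM] [s0 Ss0 s0n0] xn0; apply: contrapT => H.
have two : two_sided_ideal (fun y => forall s, S s -> s * y = 0).
  split; first split.
  - by move=> s _; rewrite mulr0.
  - by move=> y z hy hz s Ss; rewrite mulrBr hy // hz // subr0.
  - by move=> y t hy s Ss; rewrite mulrA hy // mul0r.
  - by move=> y t hy s Ss; rewrite mulrA hy //; apply: SM.
case: (simp _ two) => h.
  apply: xn0; apply/h => s Ss; apply: contrapT => sx; apply: H; by exists s.
by apply: s0n0; rewrite -[s0]mulr1; apply: h.
Qed.

Definition minimal_right_ideal S : Prop :=
  [/\ right_ideal S, (exists2 s, S s & s <> 0) &
      forall K, right_ideal K -> (exists2 s, K s & s <> 0) ->
        (forall x, K x -> S x) -> forall x, S x -> K x].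

Lemma exists_minimal_right_ideal W : right_artinian T -> right_ideal W ->
  (exists2 s, W s & s <> 0) ->
  exists2 S, minimal_right_ideal S & forall x, S x -> W x.
Proof.
move=> art WI Wn0.
have [||S [SI Sn0 SW] Smin] := @artinian_min
  (fun K => [/\ right_ideal K, exists2 s, K s & s <> 0 & forall x, K x -> W x]) art.
- by move=> K [].
- by exists W.
exists S => //; split=> // K KI Kn0 KS; apply: Smin => //; split=> // x Kx.
by apply/SW/KS.
Qed.

Lemma right_ideal_mull S (s : T) : right_ideal S ->
  right_ideal (fun y => exists2 x, S x & y = s * x).
Proof.
case=> S0 SB SM; split.
- by exists 0 => //; rewrite mulr0.
- by move=> _ _ [x Sx ->] [y Sy ->]; exists (x - y); [apply: SB | rewrite mulrBr].
- by move=> _ t [x Sx ->]; exists (x * t); [apply: SM | rewrite mulrA].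
Qed.

Lemma right_ideal_annr (s : T) : right_ideal (fun y => s * y = 0).
Proof.
split; first by rewrite mulr0.
- by move=> x y hx hy; rewrite mulrBr hx hy subr0.
- by move=> x t hx; rewrite mulrA hx mul0r.
Qed.

Lemma right_idealI S W : right_ideal S -> right_ideal W ->
  right_ideal (fun y => S y /\ W y).
Proof.
move=> [S0 SB SM] [W0 WB WM]; split=> //.
- by move=> x y [? ?] [? ?]; split; [apply: SB | apply: WB].
- by move=> x t [? ?]; split; [apply: SM | apply: WM].
Qed.

(** Brauer's lemma: some [s] in [S] has [s * S = S], so [s = s * e] with [e] in [S]. Then
    [e * e - e] lies in the annihilator of [s] in [S], which is zero by minimality. *)
Lemma minimal_right_ideal_idem S : simple_ring T -> minimal_right_ideal S ->
  exists e, [/\ S e, e <> 0 & e * e = e].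
Proof.
move=> simp [SI [s0 Ss0 s0n0] Smin].
have [s Ss ss0] := right_ideal_prime simp SI (ex_intro2 _ _ s0 Ss0 s0n0) s0n0.
have [S0 SB SM] := SI.
have [|x|e Se es] := Smin _ (right_ideal_mull s SI) _ _ s Ss.
- by exists (s * s0) => //; exists s0.
- by case=> y Sy ->; apply: SM.
have sn0 : s <> 0 by move=> s_0; apply: ss0; rewrite s_0 mul0r.
exists e; split=> //; first by move=> e0; apply: sn0; rewrite es e0 mulr0.
apply: contrapT => een.
have := Smin _ (right_idealI SI (right_ideal_annr s)) _ _ e Se.
case.
- exists (e * e - e); last by move/eqP; rewrite subr_eq0 => /eqP.
  by split; [apply/SB => //; apply: SM | rewrite mulrBr mulrA -es -es subrr].
- by move=> x [].
- by move=> _; rewrite -es.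
Qed.

(** Adding an orthogonal idempotent [d] to [e] strictly shrinks the right annihilator, since [d]
    leaves it; so an [e] with minimal annihilator cannot be enlarged. *)
Lemma idem_max (C : T -> Prop) : right_artinian T -> (exists e, C e) ->
  (forall e, C e -> e * e = e) ->
  exists2 e, C e & forall d, d <> 0 -> d * d = d -> e * d = 0 -> d * e = 0 -> ~ C (e + d).
Proof.
move=> art [e0 Ce0] Cid.
have [||K [e [Ce KE]] Kmin] := @artinian_min
  (fun K => exists e, C e /\ K = (fun y => e * y = 0)) art.
- by move=> K [e [_ ->]]; apply: right_ideal_annr.
- by exists (fun y => e0 * y = 0), e0.
exists e => // d dn0 dd ed de Ced; apply: dn0.
have := Kmin _ (ex_intro _ _ (conj Ced erefl)) _ d.
rewrite KE mulrDl ed add0r dd; apply=> // x h.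
have : e * ((e + d) * x) = 0 by rewrite h mulr0.
by rewrite mulrA mulrDr (Cid _ Ce) ed addr0.
Qed.

(** An idempotent found inside the right annihilator of [e] is orthogonal to [e] on one side only;
    the factor [1 - e] repairs the other side. *)
Lemma idem_orthogonalize e (d : T) : e * e = e -> d * d = d -> d <> 0 -> e * d = 0 ->
  let d' := d * (1 - e) in
  [/\ d' <> 0, d' * d' = d', e * d' = 0 & d' * e = 0].
Proof.
move=> ee dd dn0 ed /=.
have h : (1 - e) * d = d by rewrite mulrBl mul1r ed subr0.
have d'd : d * (1 - e) * d = d by rewrite -mulrA h.
split.
- by move=> d0; apply: dn0; rewrite -d'd d0 mul0r.
- by rewrite mulrA d'd.
- by rewrite mulrA ed mul0r.
- by rewrite -mulrA mulrBl mul1r ee subrr mulr0.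
Qed.

Lemma idem_add e (d : T) : e * e = e -> d * d = d -> e * d = 0 -> d * e = 0 ->
  (e + d) * (e + d) = e + d.
Proof. by move=> ee dd ed de; rewrite mulrDl !mulrDr ee dd ed de addr0 add0r. Qed.

(** A maximal idempotent [e] of [I] generates [I], and [k] is [1 - e]: a nonzero [(1 - e) * x] in
    [I] is killed by [e], and a minimal right ideal among such elements would provide an idempotent
    to add to [e]. *)
Lemma right_ideal_complement I : simple_ring T -> right_artinian T -> right_ideal I ->
  exists k, I (1 - k) /\ forall x, I x -> k * x = 0.
Proof.
move=> simp art II; have [I0 IB IM] := II.
have ID x y : I x -> I y -> I (x + y).
  by move=> Ix Iy; rewrite -[y]opprK; apply: (IB) => //; rewrite -sub0r; apply: IB.
have [||e [ee Ie] emax] := @idem_max (fun e => e * e = e /\ I e) art.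
- by exists 0; rewrite mulr0.
- by move=> e [].
exists (1 - e); split; first by rewrite opprB addrC subrK.
move=> x Ix; apply: contrapT => nx.
have WI := right_idealI II (right_ideal_annr e).
have [|S minS SW] := exists_minimal_right_ideal art WI.
  exists ((1 - e) * x) => //; split.
    by rewrite mulrBl mul1r; apply: IB => //; apply: IM.
  by rewrite mulrA mulrBr mulr1 ee subrr mul0r.
have [d [Sd dn0 dd]] := minimal_right_ideal_idem simp minS.
have [Id ed] := SW _ Sd.
have [d'n0 d'd' ed' d'e] := idem_orthogonalize ee dd dn0 ed.
apply: (emax _ d'n0 d'd' ed' d'e); split; first exact: idem_add.
by apply: ID => //; apply: IM.
Qed.

(** The sets [U i] are not assumed additive. An idempotent of a minimal right ideal is a single
    product [s * x * t] with [x] in [U n], so each enlargement of [e] costs exactly one new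
    index. *)
Lemma unit_sum_of_biclosed (U : nat -> T -> Prop) : simple_ring T -> right_artinian T ->
  (forall i x t, U i x -> U i (x * t) /\ U i (t * x)) ->
  (forall i, exists2 x, U i x & x <> 0) ->
  exists n (u : nat -> T), (forall i, (i < n)%N -> U i (u i)) /\ 1 = \sum_(i < n) u i.
Proof.
move=> simp art UM Un0.
pose C e := e * e = e /\ exists n (u : nat -> T),
  (forall i, (i < n)%N -> U i (u i)) /\ e = \sum_(i < n) u i.
have [||e [ee [n [u [uU eE]]]] emax] := @idem_max C art.
- exists 0; split; first by rewrite mulr0.
  by exists 0%N, (fun=> 0); rewrite big_ord0.
- by move=> e [].
case: (eqVneq e 1) => [e1|/eqP en1]; first by exists n, u; rewrite -e1.
have [|S minS SW] := exists_minimal_right_ideal art (right_ideal_annr e).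
  exists (1 - e); first by rewrite mulrBr mulr1 ee subrr.
  by move/eqP; rewrite subr_eq0 eq_sym => /eqP.
have [d [Sd dn0 dd]] := minimal_right_ideal_idem simp minS.
have ed := SW _ Sd.
have [x Ux xn0] := Un0 n.
have [SI Sn0 Smin] := minS.
have [s Ss sx] := right_ideal_prime simp SI Sn0 xn0.
have [|||_ [t ->] dE] := Smin (fun y => exists2 z, (exists t, z = x * t) & y = s * z)
  (right_ideal_mull s _) _ _ d Sd.
- split; first by exists 0; rewrite mulr0.
  + by move=> _ _ [t ->] [t' ->]; exists (t - t'); rewrite mulrBr.
  + by move=> _ t' [t ->]; exists (t * t'); rewrite mulrA.
- by exists (s * x) => //; exists x => //; exists 1; rewrite mulr1.
- by move=> _ [_ [t ->] ->]; case: SI => _ _; apply.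
have [d'n0 d'd' ed' d'e] := idem_orthogonalize ee dd dn0 ed.
case: (emax _ d'n0 d'd' ed' d'e); split; first exact: idem_add.
exists n.+1, (fun i => if (i < n)%N then u i else d * (1 - e)); split.
  move=> i; rewrite ltnS leq_eqVlt => /orP[/eqP->|lt].
    by rewrite ltnn dE; apply: (UM _ _ _ _).1; apply: (UM _ _ _ _).2; apply: (UM _ _ _ _).1.
  by rewrite lt; apply: uU.
rewrite big_ord_recr /= ltnn; congr (_ + _); rewrite eE.
by apply: eq_bigr => i _; rewrite ltn_ord.
Qed.

End SimpleArtinian.

(** * Stable range one for algebras of matrices *)

Lemma mulrKA (T : pzRingType) (a b c : T) : a * b = c -> forall x, x * a * b = x * c.
Proof. by move=> <- x; rewrite mulrA. Qed.

Lemma idem_sub (T : pzRingType) (a b : T) :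
  a * a = a -> a * b = b -> b * a = b -> b * b = b -> (a - b) * (a - b) = a - b.
Proof. by move=> aa ab ba bb; rewrite mulrBl !mulrBr aa ab ba bb subrr subr0. Qed.

Section StableRange.
Variables (k : fieldType) (n : nat).
Local Notation T := 'M[k]_n.+1.
Variable Sub : T -> Prop.
Hypothesis Sub1 : Sub 1.
Hypothesis SubB : forall x y, Sub x -> Sub y -> Sub (x - y).
Hypothesis SubM : forall x y, Sub x -> Sub y -> Sub (x * y).
Hypothesis SubC : forall a : k, Sub a%:M.
Implicit Types (c e f g h q s x y z : T).

Let SubD x y : Sub x -> Sub y -> Sub (x + y).
Proof.
move=> Sx Sy; rewrite -[y]opprK; apply: (SubB) => //.
by rewrite -sub0r -[0](subrr 1); apply: SubB => //; apply: SubB.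
Qed.

Let Sub_horner x (p : {poly k}) : Sub x -> Sub (horner_mx x p).
Proof.
move=> Sx; elim/poly_ind: p => [|p a IH].
  by rewrite rmorph0 -[0](subrr 1); apply: SubB.
by rewrite rmorphD rmorphM /= horner_mx_X horner_mx_C; apply: SubD => //; apply: SubM.
Qed.

Lemma comm_horner f x (p : {poly k}) : f * x = x * f ->
  f * horner_mx x p = horner_mx x p * f.
Proof.
move=> fx; elim/poly_ind: p => [|p a IH]; first by rewrite rmorph0 mulr0 mul0r.
rewrite rmorphD rmorphM /= horner_mx_X horner_mx_C mulrDr mulrDl mulrA IH -!mulrA fx.
by congr (_ + _); apply: scalar_mxC.
Qed.

(* Fitting: over a field, a polynomial in x without constant term is the projection onto
   the part where x is bijective, and x is nilpotent, so 1 - x bijective, on the other part. *)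
Lemma fitting x : exists p q : {poly k}, let e := x * horner_mx x p in
  e * e = e /\ 1 - e = (1 - x) * horner_mx x q.
Proof.
have [m [g gr chiE]] := multiplicity_XsubC (char_poly x) 0.
have /= g0 : ~~ root g 0 by move: gr; rewrite monic_neq0 ?char_poly_monic.
rewrite subr0 in chiE.
(* The exponent [m.+1] instead of [m] gives [e] a factor [x] even when [m = 0]. *)
have /Bezout_eq1_coprimepP [[u v] /= uv] : coprimep g ('X ^+ m.+1).
  by rewrite coprimep_expr // -['X]subr0 coprimep_XsubC.
(* [q] contains a truncated geometric series: [1 - 'X] times the sum is [1 - 'X^m], and [g * 'X^m]
   vanishes at [x]. *)
exists (v * 'X ^+ m), ((\sum_(i < m) 'X ^+ i) * (u * g)).
have eE : x * horner_mx x (v * 'X^m) = horner_mx x (v * 'X^(m.+1)).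
  by rewrite -{1}[x]horner_mx_X -rmorphM /=; congr (horner_mx x _); rewrite exprS; ring.
have e1E : 1 - horner_mx x (v * 'X^(m.+1)) = horner_mx x (u * g).
  by rewrite -(rmorph1 (horner_mx x)) -rmorphB /= -uv addrK.
have chi0 : horner_mx x (g * 'X^m) = 0 by rewrite -chiE; apply: Cayley_Hamilton.
rewrite /= eE; split.
  apply/eqP; rewrite -subr_eq0 -{3}[horner_mx x _]mul1r -mulrBl -opprB mulNr e1E -rmorphM /=.
  have -> : u * g * (v * 'X^(m.+1)) = (g * 'X^m) * (u * v * 'X) by rewrite exprS; ring.
  by rewrite rmorphM /= chi0 mul0r oppr0.
rewrite e1E -{2}[x]horner_mx_X -(rmorph1 (horner_mx x)) -rmorphB -rmorphM /=.
have -> : (1 - 'X) * ((\sum_(i < m) 'X^i) * (u * g)) = u * g - g * 'X^m * u.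
  have := subrX1 ('X : {poly k}) m; set S := \sum_(i < m) _ => SE.
  have -> : 'X^m = 1 + ('X - 1) * S :> {poly k} by rewrite -SE; ring.
  by ring.
by rewrite rmorphB (rmorphM _ (g * 'X^m)) /= chi0 mul0r subr0.
Qed.

(** Murray-von Neumann equivalence: [c] and [s] are inverse isomorphisms between the images of [f]
    and [h], normalised to lie in the corners and required to come from [Sub]. *)
Definition idem_equiv f h : Prop := exists c s,
  [/\ Sub c, Sub s, s * c = f & c * s = h] /\ [/\ h * c = c, c * f = c, f * s = s & s * h = s].

Lemma idem_equiv_sym f h : idem_equiv f h -> idem_equiv h f.
Proof. by case=> c [s [[? ? ? ?] [? ? ? ?]]]; exists s, c. Qed.

Lemma idem_equiv_refl f : Sub f -> f * f = f -> idem_equiv f f.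
Proof. by move=> Sf ff; exists f, f. Qed.

Lemma idem_equiv_trans f g h : idem_equiv f g -> idem_equiv g h -> idem_equiv f h.
Proof.
case=> c [s [[Sc Ss sc cs] [gc cf fs sg]]] [c' [s' [[Sc' Ss' sc' cs'] [hc' cg gs hs]]]].
exists (c' * c), (s * s'); split; split; rewrite ?mulrA.
- exact: SubM.
- exact: SubM.
- by rewrite (mulrKA sc') sg.
- by rewrite (mulrKA cs) cg.
- by rewrite hc'.
- by rewrite (mulrKA cf).
- by rewrite fs.
- by rewrite (mulrKA hs).
Qed.

Lemma idem_equivD f1 f2 h1 h2 : idem_equiv f1 h1 -> idem_equiv f2 h2 ->
  f1 * f2 = 0 -> f2 * f1 = 0 -> h1 * h2 = 0 -> h2 * h1 = 0 ->
  idem_equiv (f1 + f2) (h1 + h2).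
Proof.
case=> c [s [[Sc Ss sc cs] [gc cf fs sg]]] [c' [s' [[Sc' Ss' sc' cs'] [hc' cg gs hs]]]].
move=> f12 f21 h12 h21.
have e1 : s * c' = 0 by rewrite -sg -hc' mulrA (mulrKA h12) mulr0 mul0r.
have e2 : s' * c = 0 by rewrite -hs -gc mulrA (mulrKA h21) mulr0 mul0r.
have e3 : c * s' = 0 by rewrite -cf -gs mulrA (mulrKA f12) mulr0 mul0r.
have e4 : c' * s = 0 by rewrite -cg -fs mulrA (mulrKA f21) mulr0 mul0r.
have e5 : h1 * c' = 0 by rewrite -hc' mulrA h12 mul0r.
have e6 : h2 * c = 0 by rewrite -gc mulrA h21 mul0r.
have e7 : c * f2 = 0 by rewrite -cf -mulrA f12 mulr0.
have e8 : c' * f1 = 0 by rewrite -cg -mulrA f21 mulr0.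
have e9 : f1 * s' = 0 by rewrite -gs mulrA f12 mul0r.
have e10 : f2 * s = 0 by rewrite -fs mulrA f21 mul0r.
have e11 : s * h2 = 0 by rewrite -sg -mulrA h12 mulr0.
have e12 : s' * h1 = 0 by rewrite -hs -mulrA h21 mulr0.
exists (c + c'), (s + s'); split; split; try exact: SubD;
  by rewrite mulrDl !mulrDr ?(e1, e2, e3, e4, e5, e6, e7, e8, e9, e10, e11, e12)
    ?(sc, cs, gc, cf, fs, sg, sc', cs', hc', cg, gs, hs) ?addr0 ?add0r.
Qed.

Lemma mxrankMl (x y : T) : (\rank (x * y)%R <= \rank y)%N.
Proof. exact: mxrankM_maxr. Qed.

Lemma mxrankMr (x y : T) : (\rank (x * y)%R <= \rank x)%N.
Proof. exact: mxrankM_maxl. Qed.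

Lemma idem_equiv_rank f h : idem_equiv f h -> \rank f = \rank h.
Proof.
case=> c [s [[Sc Ss sc cs] [gc cf fs sg]]]; apply/eqP; rewrite eqn_leq; apply/andP; split.
  by rewrite -sc -gc; apply: leq_trans (mxrankMl _ _) _; apply: mxrankMr.
by rewrite -cs -cf -mulrA; apply: leq_trans (mxrankMl _ _) _; apply: mxrankMr.
Qed.

Lemma idem_eq_rank q h : q * q = q -> h * q = q -> q * h = q ->
  (\rank h <= \rank q)%N -> q = h.
Proof.
move=> qq hq qh rk; rewrite -hq.
have sub : (q <= h)%MS by apply/submxP; exists q.
have := mxrank_leqif_eq sub; case=> le eqr.
have /andP[_ /submxP [D hD]] : (q == h)%MS by rewrite -eqr eqn_leq le rk.
by rewrite hD; apply: (mulrKA qq D).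
Qed.

Section Corner.
Variables (g f h : T).
Hypotheses (Sg : Sub g) (Sf : Sub f) (Sh : Sub h).
Hypotheses (gg : g * g = g) (ff : f * f = f) (hh : h * h = h).
Hypotheses (gf : g * f = f) (fg : f * g = f) (gh : g * h = h) (hg : h * g = h).

(** Here [y] inverts [f * h * f] on the image of [f]. The idempotent [g - y * h] has the kernel of
    [g - f]. It also has the image of [g - h], because a rank count gives [h * y * h = h]. So it is
    equivalent to both. *)
Lemma idem_cancel_inv y : idem_equiv f h -> Sub y -> f * y = y -> y * f = y ->
  y * h * f = f -> f * h * y = f -> idem_equiv (g - f) (g - h).
Proof.
move=> fh Sy fy yf yhf fhy.
have yhy : y * h * y = y by rewrite -{2}fy mulrA yhf fy.
have yhyK x : x * y * h * y = x * y by rewrite -!mulrA (mulrA y) yhy.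
have hyh : h * y * h = h.
  apply: idem_eq_rank; rewrite ?mulrA ?(mulrKA hh) ?hh ?yhyK //.
  rewrite -(idem_equiv_rank fh).
  have -> : f = f * (h * y * h) * y by rewrite !mulrA yhyK fhy.
  by apply: leq_trans (mxrankMr _ _) (mxrankMl _ _).
have gy : g * y = y by rewrite -fy mulrA gf.
have h'p : (g - h) * (g - y * h) = g - y * h.
  by rewrite mulrBl !mulrBr gg !mulrA gy hg hyh subrr subr0.
have f'p : (g - f) * (g - y * h) = g - f.
  by rewrite mulrBl !mulrBr gg !mulrA gy fg fy opprB addrA subrK.
have pf' : (g - y * h) * (g - f) = g - y * h.
  by rewrite mulrBl !mulrBr gg gf (mulrKA hg) yhf opprB addrA subrK.
have ph' : (g - y * h) * (g - h) = g - h.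
  by rewrite mulrBl !mulrBr gg gh (mulrKA hg) (mulrKA hh) subrr subr0.
have f'f' : (g - f) * (g - f) = g - f.
  by rewrite mulrBl !mulrBr gg gf fg ff subrr subr0.
have h'h' : (g - h) * (g - h) = g - h.
  by rewrite mulrBl !mulrBr gg gh hg hh subrr subr0.
exists ((g - y * h) * (g - f)), ((g - f) * (g - h)).
have Sp : Sub (g - y * h) by apply: SubB => //; apply: SubM.
have Sf' : Sub (g - f) by apply: SubB.
have Sh' : Sub (g - h) by apply: SubB.
split; split; rewrite ?mulrA ?(mulrKA h'p) ?h'p ?f'p ?pf' ?ph' ?f'f' ?pf' ?ph'
  ?(mulrKA h'h') ?(mulrKA f'f') //; exact: SubM.
Qed.
End Corner.


(** Induction on the rank of [f], guided by the Fitting decomposition of the compression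
    [f * h * f]: it is bijective on the image of [f], or nilpotent there, or it cuts [f] into two
    smaller pieces that are cancelled one after the other. *)
Lemma idem_cancel g f h : Sub g -> Sub f -> Sub h ->
  g * g = g -> f * f = f -> h * h = h ->
  g * f = f -> f * g = f -> g * h = h -> h * g = h ->
  idem_equiv f h -> idem_equiv (g - f) (g - h).
Proof.
have [r] := ubnP (\rank f); elim: r g f h => // r IH g f h.
rewrite ltnS => rk Sg Sf Sh gg ff hh gf fg gh hg fh.
pose x := f * h * f; have Sx : Sub x by do 2?[apply: SubM => //].
have fx : f * x = x by rewrite /x !mulrA ff.
have xf : x * f = x by rewrite /x (mulrKA ff).
have [p [q [ee e1E]]] := fitting x.
have := comm_horner q (etrans fx (esym xf)); have := comm_horner p (etrans fx (esym xf)).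
have := comm_horner q (erefl (x * x)); have := comm_horner p (erefl (x * x)).
have := Sub_horner p Sx; have := Sub_horner q Sx.
move: ee e1E; set y := horner_mx x p; set z := horner_mx x q => ee e1E Sz Sy xy xz fy fz.
set e := x * y in ee e1E.
have Se : Sub e by apply: SubM.
have fe : f * e = e by rewrite /e mulrA fx.
have ef : e * f = e by rewrite /e -mulrA -fy mulrA xf.
(* Bijective case: [f * y] is the inverse of [f * h * f] on the image of [f]. *)
have [e1_0|/eqP e1n0] := eqVneq (f - e) 0.
  have eE : e = f by apply/esym/eqP; rewrite -subr_eq0 e1_0.
  apply: (@idem_cancel_inv g f h _ _ _ _ _ _ _ _ _ _ (f * y)) => //.
  - exact: SubM.
  - by rewrite mulrA ff.
  - by rewrite -mulrA -fy mulrA ff.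
  - by rewrite fy -mulrA -mulrA mulrA -[RHS]eE /e xy -!mulrA; congr (_ * _); rewrite /x !mulrA.
  - by rewrite mulrA -/x -/e eE.
(* Nilpotent case: the compression of the complement [h' = g - h] is [f * (1 - x)], which is
   invertible on the image of [f] with inverse [Y]. *)
have [e0|/eqP en0] := eqVneq e 0.
  pose Y := f * z; have SY : Sub Y by apply: SubM.
  have fY : f * Y = Y by rewrite /Y mulrA ff.
  have Yf : Y * f = Y by rewrite /Y -mulrA -fz mulrA ff.
  have zE : (1 - x) * z = 1 by rewrite -e1E e0 subr0.
  have zE' : z * (1 - x) = 1 by rewrite mulrBr -xz mulr1 -[z in z - _]mul1r -mulrBl.
  have [h' h'E] : exists h', h' = g - h by exists (g - h).
  have Sh' : Sub h' by rewrite h'E; apply: SubB.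
  have gh' : g * h' = h' by rewrite h'E mulrBr gg gh.
  have h'g : h' * g = h' by rewrite h'E mulrBl gg hg.
  have h'h' : h' * h' = h' by rewrite {2}h'E mulrBr h'g h'E mulrBl gh hh subrr subr0.
  have hh' : h * h' = 0 by rewrite h'E mulrBr hg hh subrr.
  have h'h : h' * h = 0 by rewrite h'E mulrBl gh hh subrr.
  have w : f * h' * f = f * (1 - x).
    by rewrite h'E [RHS]mulrBr mulr1 fx mulrBr mulrBl fg ff -/x.
  have wY : f * h' * f * Y = f.
    by rewrite w /Y fz mulrA (mulrKA zE) mulr1 ff.
  have Yh'f : Y * h' * f = f.
    by rewrite -[X in X * h' * f]Yf -2!mulrA (mulrA f) w mulrA Yf /Y -mulrA zE' mulr1.
  have fh'Y : f * h' * Y = f by rewrite -[X in _ * X]fY mulrA.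
  have Yh'Y : Y * h' * Y = Y by rewrite -[X in _ * X]fY mulrA Yh'f fY.
  (* [q'] is a copy of [f] below [h'] to which the bijective case applies. Being equivalent and
     orthogonal to [h], it can trade places with [h] in [g - q' = h + (h' - q')]. *)
  clearbody Y; pose q' := h' * Y * h'.
  have YK u : u * Y * h' * Y = u * Y by rewrite -!mulrA (mulrA Y) Yh'Y.
  have fq : idem_equiv f q'.
    exists (h' * Y), (f * h'); split; split; rewrite ?mulrA ?(mulrKA h'h') ?h'h' ?ff //.
    1,2: exact: SubM.
    1-3: by rewrite /q' ?mulrA ?(mulrKA h'h') ?(mulrKA Yf) ?(mulrKA h'h') ?fh'Y ?YK ?fY ?ff.
  have Sq' : Sub q' by do 2?[apply: SubM => //].
  have h'q' : h' * q' = q' by rewrite /q' !mulrA h'h'.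
  have q'h' : q' * h' = q' by rewrite /q' (mulrKA h'h').
  have q'q' : q' * q' = q' by rewrite {2}/q' !mulrA q'h' /q' -!mulrA (mulrA Y) (mulrA _ Y) Yh'Y.
  have q'h : q' * h = 0 by rewrite -q'h' -mulrA h'h mulr0.
  have hq' : h * q' = 0 by rewrite -h'q' mulrA hh' mul0r.
  have gq' : g * q' = q' by rewrite -h'q' mulrA gh'.
  have q'g : q' * g = q' by rewrite -q'h' -mulrA h'g.
  have gfq : idem_equiv (g - f) (g - q').
    apply: (@idem_cancel_inv g f q' _ _ _ _ _ _ _ _ _ _ Y) => //.
      by rewrite /q' !mulrA Yh'Y Yh'f.
    by rewrite /q' !mulrA fh'Y fh'Y.
  apply: idem_equiv_trans gfq _.
  have -> : g - q' = h + (h' - q') by rewrite h'E addrA addrCA subrr addr0.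
  have -> : g - h = q' + (h' - q') by rewrite addrCA subrr addr0 h'E.
  apply: idem_equivD.
  - exact: idem_equiv_trans (idem_equiv_sym fh) fq.
  - apply: idem_equiv_refl; first exact: SubB.
    by rewrite mulrBl !mulrBr h'h' h'q' q'h' q'q' subrr subr0.
  - by rewrite mulrBr hh' hq' subrr.
  - by rewrite mulrBl h'h q'h subrr.
  - by rewrite mulrBr q'h' q'q' subrr.
  - by rewrite mulrBl h'q' q'q' subrr.
(* Mixed case: [e] and [e1] both differ from [f], hence have smaller rank; [h1] and [h2] are their
   copies below [h]. *)
clearbody e; case: fh => c [s [[Sc Ss sc cs] [hc cf fs sh]]].
pose e1 := f - e; have Se1 : Sub e1 by apply: SubB.
have ee1 : e * e1 = 0 by rewrite mulrBr ef ee subrr.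
have e1e : e1 * e = 0 by rewrite mulrBl fe ee subrr.
have e1e1 : e1 * e1 = e1 by rewrite {2}/e1 mulrBr e1e subr0 mulrBl ff ef.
have fe1 : f * e1 = e1 by rewrite mulrBr ff fe.
have e1f : e1 * f = e1 by rewrite mulrBl ff ef.
have rk_lt d : d * d = d -> f * d = d -> d * f = d -> d <> f -> (\rank d < r)%N.
  move=> dd fd df df'; apply: leq_trans rk; rewrite ltnNge; apply/negP => le.
  exact/df'/(idem_eq_rank dd fd df).
pose h1 := c * e * s; pose h2 := c * e1 * s.
have Sh1 : Sub h1 by do 2?[apply: SubM => //].
have Sh2 : Sub h2 by do 2?[apply: SubM => //].
have scK a : a * s * c = a * f by rewrite -mulrA sc.
have sub_equiv d : Sub d -> f * d = d -> d * f = d -> d * d = d -> idem_equiv d (c * d * s).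
  move=> Sd fd df dd; exists (c * d), (d * s).
  split; split; rewrite ?mulrA ?scK ?(mulrKA dd) ?(mulrKA df) ?df ?dd ?(mulrKA dd) ?dd //.
  - exact: SubM.
  - exact: SubM.
have eh1 : idem_equiv e h1 := sub_equiv _ Se fe ef ee.
have eh2 : idem_equiv e1 h2 := sub_equiv _ Se1 fe1 e1f e1e1.
have h1h1 : h1 * h1 = h1 by rewrite /h1 !mulrA scK (mulrKA ef) (mulrKA ee).
have h2h2 : h2 * h2 = h2 by rewrite /h2 !mulrA scK (mulrKA e1f) (mulrKA e1e1).
have h12 : h1 * h2 = 0 by rewrite /h1 /h2 !mulrA scK (mulrKA ef) (mulrKA ee1) mulr0 mul0r.
have h21 : h2 * h1 = 0 by rewrite /h1 /h2 !mulrA scK (mulrKA e1f) (mulrKA e1e) mulr0 mul0r.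
have hE : h = h1 + h2 by rewrite -mulrDl -mulrDr addrC subrK cf cs.
have gc : g * c = c by rewrite -hc mulrA gh.
have sg : s * g = s by rewrite -sh -mulrA hg.
have ge : g * e = e by rewrite -fe mulrA gf.
have eg : e * g = e by rewrite -ef -mulrA fg.
have ge1 : g * e1 = e1 by rewrite -fe1 mulrA gf.
have e1g : e1 * g = e1 by rewrite -e1f -mulrA fg.
have gh1 : g * h1 = h1 by rewrite /h1 !mulrA gc.
have h1g : h1 * g = h1 by rewrite /h1 -mulrA sg.
have gh2 : g * h2 = h2 by rewrite /h2 !mulrA gc.
have h2g : h2 * g = h2 by rewrite /h2 -mulrA sg.
have e1def : e1 = f - e by [].
clearbody h1 h2 e1.
have geh1 : idem_equiv (g - e) (g - h1).
  apply: IH => //; apply: rk_lt => // ef'; apply: e1n0; by rewrite ef' subrr.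
case: geh1 => c' [s' [[Sc' Ss' sc' cs'] [hc' cf' fs' sh']]].
have gh1h2 : (g - h1) * h2 = h2 by rewrite mulrBl gh2 h12 subr0.
have h2gh1 : h2 * (g - h1) = h2 by rewrite mulrBr h2g h21 subr0.
have c's'K a : a * c' * s' = a * (g - h1) by rewrite -mulrA cs'.
(* The equivalence just obtained carries [h2], which lies below [g - h1], to [h2'] below [g - e],
   where [e1] can be cancelled against it. *)
pose h2' := s' * h2 * c'.
have Sh2' : Sub h2' by do 2?[apply: SubM => //].
have Sge : Sub (g - e) by apply: SubB.
have h2'h2' : h2' * h2' = h2' by rewrite /h2' !mulrA c's'K (mulrKA h2gh1) (mulrKA h2h2).
have geh2' : (g - e) * h2' = h2' by rewrite /h2' !mulrA fs'.
have h2'ge : h2' * (g - e) = h2' by rewrite /h2' -mulrA cf'.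
have h2h2'_equiv : idem_equiv h2 h2'.
  exists (s' * h2), (h2 * c').
  split; split; rewrite ?mulrA ?c's'K ?fs' ?h2gh1 ?(mulrKA h2gh1) ?h2h2 ?(mulrKA h2h2) //.
  - exact: SubM.
  - exact: SubM.
have gege : (g - e) * (g - e) = g - e by rewrite mulrBl !mulrBr gg ge eg ee subrr subr0.
have : idem_equiv (g - e - e1) (g - e - h2').
  apply: IH => //.
  - apply: rk_lt => // e1f'; apply: en0; by rewrite -[e]fe -e1f' e1e.
  - by rewrite mulrBl ge1 ee1 subr0.
  - by rewrite mulrBr e1g e1e subr0.
  - exact: idem_equiv_trans eh2 h2h2'_equiv.
have -> : g - e - e1 = g - f by rewrite e1def opprB addrA subrK.
move/idem_equiv_trans; apply.
have -> : g - h = g - h1 - h2 by rewrite hE opprD addrA.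
exists (c' * (g - e - h2')), ((g - e - h2') * s').
have c'h2' : c' * h2' = h2 * c' by rewrite /h2' !mulrA cs' gh1h2.
have h2's' : h2' * s' = s' * h2 by rewrite /h2' c's'K (mulrKA h2gh1).
clearbody h2'.
have dd : (g - e - h2') * (g - e - h2') = g - e - h2'.
  exact: idem_sub.
have E1 : c' * (g - e - h2') = (g - h1 - h2) * c' by rewrite mulrBr cf' c'h2' mulrBl hc'.
have E2 : (g - e - h2') * s' = s' * (g - h1 - h2) by rewrite mulrBl fs' h2's' mulrBr sh'.
have d2 : (g - h1 - h2) * (g - h1 - h2) = g - h1 - h2.
  by apply: idem_sub => //; apply: idem_sub.
have Sd : Sub (g - e - h2') by apply: SubB.
split; split.
- exact: SubM.
- exact: SubM.
- have dge : (g - e - h2') * (g - e) = g - e - h2' by rewrite mulrBl gege h2'ge.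
  by rewrite -mulrA (mulrA s') sc' mulrA dge dd.
- have h1d : (g - h1 - h2) * (g - h1) = g - h1 - h2.
    by rewrite mulrBl h2gh1 mulrBl !mulrBr gg gh1 h1g h1h1 subrr subr0.
  by rewrite mulrA -(mulrA c') dd E1 -mulrA cs' h1d.
- by rewrite E1 mulrA d2.
- by rewrite -mulrA dd.
- by rewrite mulrA dd.
- by rewrite E2 -mulrA d2.
Qed.

(** Fitting applied to [a * x] gives an idempotent [e = a * s] with [1 - e = b * z]. The element
    [e * a] maps the image of [f = s * a] isomorphically to that of [e], cancellation supplies an
    isomorphism [c] between the complements, and [e * a + c] is the desired unit. *)
Lemma stable_range a x b : Sub a -> Sub x -> Sub b -> a * x + b = 1 ->
  exists y, Sub y /\ a + b * y \is a GRing.unit.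
Proof.
move=> Sa Sx Sb axb1.
have [p [q [ee e1E]]] := fitting (a * x).
have Sax : Sub (a * x) by apply: SubM.
have := Sub_horner p Sax; have := Sub_horner q Sax.
move: ee e1E; set y := horner_mx _ p; set z := horner_mx _ q.
set e := a * x * y => ee e1E Sz Sy.
have Se : Sub e by apply: SubM.
have e1bz : 1 - e = b * z by rewrite e1E; congr (_ * _); rewrite -axb1 addrC addKr.
have eE : a * x * y = e by [].
clearbody e; pose s := x * y * e; pose f := s * a.
have ase : a * s = e by rewrite /s !mulrA eE ee.
have se : s * e = s by rewrite /s -mulrA ee.
have Ss : Sub s by do 2?[apply: SubM => //].
clearbody s; have ff : f * f = f by rewrite /f mulrA -(mulrA s) ase se.
have Sf : Sub f by apply: SubM.
have fe : idem_equiv f e.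
  exists (e * a), s; split; split; rewrite ?mulrA ?ee ?se //.
  - exact: SubM.
  - by rewrite -mulrA ase ee.
  - by rewrite /f ?mulrA -(mulrA e) ase ee.
  - by rewrite /f -mulrA ase se.
have := idem_cancel Sub1 Sf Se (mulr1 1) ff ee (mul1r f) (mulr1 f) (mul1r e) (mulr1 e) fe.
case=> c [t [[Sc St tc ct] [hc cf ft th]]].
have ec : e * c = 0 by rewrite -hc mulrA mulrBr mulr1 ee subrr mul0r.
have te : t * e = 0 by rewrite -th -mulrA mulrBl mul1r ee subrr mulr0.
exists (z * (c - a)); split; first by apply: SubM => //; apply: SubB.
have -> : a + b * (z * (c - a)) = e * a + c.
  by rewrite mulrA -e1bz mulrBr hc mulrBl mul1r opprB addrCA [a + _]addrC subrK addrC.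
have inv : (s + t) * (e * a + c) = 1.
  have sc : s * c = 0 by rewrite -se -mulrA ec mulr0.
  by rewrite mulrDl !mulrDr !mulrA se te tc sc mul0r addr0 add0r -/f addrC subrK.
by have [] := mulmx1_unit inv.
Qed.

End StableRange.

(** * Endomorphism rings *)

Section Ract.
Variables (R : comNzRingType) (L : algType R) (Z : lmodType L^c).
Implicit Types (x y z : Z) (a b : L) (r s : R).

Lemma ractDl x y a : ract (x + y) a = ract x a + ract y a.
Proof. exact: scalerDr. Qed.
Lemma ractBl x y a : ract (x - y) a = ract x a - ract y a.
Proof. exact: scalerBr. Qed.
Lemma ractDr x a b : ract x (a + b) = ract x a + ract x b.
Proof. exact: scalerDl. Qed.
Lemma ractNr x a : ract x (- a) = - ract x a.
Proof. exact: scaleNr. Qed.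
Lemma ractBr x a b : ract x (a - b) = ract x a - ract x b.
Proof. exact: scalerBl. Qed.
Lemma ractA x a b : ract (ract x a) b = ract x (a * b).
Proof. exact: scalerA. Qed.
Lemma ract1 x : ract x 1 = x.
Proof. exact: scale1r. Qed.
Lemma ract0r x : ract x 0 = 0.
Proof. exact: scale0r. Qed.
Lemma ract0l a : ract (0 : Z) a = 0.
Proof. exact: scaler0. Qed.
Lemma ract_suml I (r : seq I) (P : pred I) (F : I -> Z) a :
  ract (\sum_(i <- r | P i) F i) a = \sum_(i <- r | P i) ract (F i) a.
Proof. exact: scaler_sumr. Qed.
Lemma ract_sumr I (r : seq I) (P : pred I) (F : I -> L) x :
  ract x (\sum_(i <- r | P i) F i) = \sum_(i <- r | P i) ract x (F i).
Proof. exact: (scaler_suml (R := L^c)). Qed.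
Lemma ract_algC x a r : ract (ract x a) r%:A = ract (ract x r%:A) a.
Proof. by rewrite !ractA mulr_algl mulr_algr. Qed.
Lemma ract_algA x r s : ract (ract x r%:A) s%:A = ract x (r * s)%:A.
Proof. by rewrite ractA mulr_algl scalerA. Qed.

Definition tfree : Prop := forall x r, r <> 0 -> ract x r%:A = 0 -> x = 0.

End Ract.

Section Rlinear.
Variables (R : comNzRingType) (L : algType R) (Z W : lmodType L^c) (f : Z -> W).
Hypothesis fl : rlinear f.

Lemma rlinearD x y : f (x + y) = f x + f y. Proof. exact: fl.1. Qed.
Lemma rlinear_ract x a : f (ract x a) = ract (f x) a. Proof. exact: fl.2. Qed.
Lemma rlinear0 : f 0 = 0.
Proof. by have := rlinear_ract 0 0; rewrite !ract0r. Qed.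
Lemma rlinearN x : f (- x) = - f x.
Proof. by apply/eqP; rewrite -addr_eq0 -rlinearD addNr rlinear0. Qed.
Lemma rlinearB x y : f (x - y) = f x - f y.
Proof. by rewrite rlinearD rlinearN. Qed.
Lemma rlinear_sum I (r : seq I) (P : pred I) (F : I -> Z) :
  f (\sum_(i <- r | P i) F i) = \sum_(i <- r | P i) f (F i).
Proof. exact: (big_morph f rlinearD rlinear0). Qed.
End Rlinear.

Section Endo.
Variables (R : comNzRingType) (L : algType R) (Z : lmodType L^c).

Record endo := Endo { efun :> Z -> Z; efunP : rlinear efun }.

Lemma endoP (f g : endo) : f =1 g -> f = g.
Proof.
case: f g => f fP [g gP] /= /funext fg; rewrite {f}fg in fP *.
by rewrite (Prop_irrelevance fP gP).
Qed.

HB.instance Definition _ := gen_eqMixin endo.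
HB.instance Definition _ := gen_choiceMixin endo.

Lemma endo_add_subproof (f g : endo) : rlinear (fun z => f z + g z).
Proof.
split=> [x y|x a]; first by rewrite !(rlinearD (efunP _)) addrACA.
by rewrite !(rlinear_ract (efunP _)) ractDl.
Qed.
Lemma endo_opp_subproof (f : endo) : rlinear (fun z => - f z).
Proof.
split=> [x y|x a]; first by rewrite (rlinearD (efunP _)) opprD.
by rewrite (rlinear_ract (efunP _)) -[LHS]sub0r -[X in X - _](ract0l Z a) -ractBl sub0r.
Qed.
Lemma endo_zero_subproof : rlinear (fun z : Z => 0 : Z).
Proof. by split=> [x y|x a]; rewrite ?addr0 ?ract0l. Qed.
Lemma endo_one_subproof : rlinear (fun z : Z => z).
Proof. by []. Qed.
Lemma endo_mul_subproof (f g : endo) : rlinear (fun z => f (g z)).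
Proof.
split=> [x y|x a]; first by rewrite !(rlinearD (efunP _)).
by rewrite !(rlinear_ract (efunP _)).
Qed.
Lemma endo_scale_subproof (r : R) (f : endo) : rlinear (fun z => ract (f z) r%:A).
Proof.
split=> [x y|x a]; first by rewrite (rlinearD (efunP _)) ractDl.
by rewrite (rlinear_ract (efunP _)) ract_algC.
Qed.

Definition endo_add f g := Endo (endo_add_subproof f g).
Definition endo_opp f := Endo (endo_opp_subproof f).
Definition endo_zero := Endo endo_zero_subproof.
Definition endo_one := Endo endo_one_subproof.
Definition endo_mul f g := Endo (endo_mul_subproof f g).
Definition endo_scale r f := Endo (endo_scale_subproof r f).

Lemma endo_addA : associative endo_add.
Proof. by move=> f g h; apply: endoP => z /=; rewrite addrA. Qed.
Lemma endo_addC : commutative endo_add.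
Proof. by move=> f g; apply: endoP => z /=; rewrite addrC. Qed.
Lemma endo_add0 : left_id endo_zero endo_add.
Proof. by move=> f; apply: endoP => z /=; rewrite add0r. Qed.
Lemma endo_addN : left_inverse endo_zero endo_opp endo_add.
Proof. by move=> f; apply: endoP => z /=; rewrite addNr. Qed.

HB.instance Definition _ := GRing.isZmodule.Build endo endo_addA endo_addC endo_add0 endo_addN.

Lemma endo_mulA : associative endo_mul. Proof. by move=> f g h; apply: endoP. Qed.
Lemma endo_mul1 : left_id endo_one endo_mul. Proof. by move=> f; apply: endoP. Qed.
Lemma endo_mulr1 : right_id endo_one endo_mul. Proof. by move=> f; apply: endoP. Qed.
Lemma endo_mulDl : left_distributive endo_mul endo_add.
Proof. by move=> f g h; apply: endoP. Qed.
Lemma endo_mulDr : right_distributive endo_mul endo_add.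
Proof. by move=> f g h; apply: endoP => z /=; rewrite (rlinearD (efunP _)). Qed.

HB.instance Definition _ := GRing.Zmodule_isPzRing.Build endo
  endo_mulA endo_mul1 endo_mulr1 endo_mulDl endo_mulDr.

Lemma endo_scaleA r s f : endo_scale r (endo_scale s f) = endo_scale (r * s) f.
Proof. by apply: endoP => z /=; rewrite ract_algA mulrC. Qed.
Lemma endo_scale1 : left_id 1 endo_scale.
Proof. by move=> f; apply: endoP => z /=; rewrite scale1r ract1. Qed.
Lemma endo_scaleDr : right_distributive endo_scale +%R.
Proof. by move=> r f g; apply: endoP => z /=; rewrite ractDl. Qed.
Lemma endo_scaleDl f : {morph endo_scale^~ f : r s / r + s}.
Proof. by move=> r s; apply: endoP => z /=; rewrite scalerDl ractDr. Qed.

HB.instance Definition _ := GRing.Zmodule_isLmodule.Build R endo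
  endo_scaleA endo_scale1 endo_scaleDr endo_scaleDl.

Lemma endoD (f g : endo) z : (f + g) z = f z + g z. Proof. by []. Qed.
Lemma endoB (f g : endo) z : (f - g) z = f z - g z. Proof. by []. Qed.
Lemma endoM (f g : endo) z : (f * g) z = f (g z). Proof. by []. Qed.
Lemma endoZ r (f : endo) z : (r *: f) z = ract (f z) r%:A. Proof. by []. Qed.
Lemma endoZl r (f g : endo) : r *: f * g = r *: (f * g). Proof. exact: endoP. Qed.
Lemma endoZr r (f g : endo) : f * (r *: g) = r *: (f * g).
Proof. by apply: endoP => z; rewrite !(endoM, endoZ) (rlinear_ract (efunP f)). Qed.

Lemma endo_sum I (r : seq I) (P : pred I) (F : I -> endo) z :
  (\sum_(i <- r | P i) F i) z = \sum_(i <- r | P i) F i z.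
Proof. exact: (big_morph (fun f : endo => f z) (fun _ _ => erefl) erefl). Qed.

End Endo.

(** * Endomorphisms of modules finitely generated over the base ring *)

Section Corners.
Variables (R : comNzRingType) (L : algType R) (Z : lmodType L^c).
Local Notation E := (endo Z).
Implicit Types (f g h c p q t u v : E) (r s : R).

(** For idempotents [t] and [c] these are the homomorphisms from the summand [c Z] to the summand
    [t Z], extended by zero. *)
Definition in_corner (t c f : E) : Prop := t * f = f /\ f * c = f.

Lemma in_cornerD t c f g : in_corner t c f -> in_corner t c g -> in_corner t c (f + g).
Proof. by move=> [tf fc] [tg gc]; split; rewrite (mulrDr, mulrDl) ?tf ?tg ?fc ?gc. Qed.

Lemma in_cornerB t c f g : in_corner t c f -> in_corner t c g -> in_corner t c (f - g).
Proof. by move=> [tf fc] [tg gc]; split; rewrite (mulrBr, mulrBl) ?tf ?tg ?fc ?gc. Qed.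

Lemma in_cornerZ t c r f : in_corner t c f -> in_corner t c (r *: f).
Proof. by move=> [tf fc]; split; rewrite (endoZr, endoZl) ?tf ?fc. Qed.

Lemma in_cornerM t c d f g : in_corner t d f -> in_corner d c g -> in_corner t c (f * g).
Proof. by move=> [tf _] [_ gc]; split; rewrite ?mulrA ?tf // -mulrA gc. Qed.

Lemma in_corner_idem c : c * c = c -> in_corner c c c. Proof. by []. Qed.

Lemma in_corner_wide t' c' t c f : t' * t = t -> c * c' = c -> in_corner t c f ->
  in_corner t' c' f.
Proof. by move=> t't cc' [tf fc]; split; [rewrite -tf mulrA t't | rewrite -fc -mulrA cc']. Qed.

Definition Rspan n (x : 'I_n.+1 -> Z) c : Prop :=
  (forall i, c (x i) = x i) /\
  forall z, exists r : 'I_n.+1 -> R, c z = \sum_i ract (x i) (r i)%:A.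

Definition Rfin c : Prop := exists n (x : 'I_n.+1 -> Z), Rspan x c.

(** * Matrices of endomorphisms with respect to a generating family *)

Section Represent.
Variables (n : nat) (x : 'I_n.+1 -> Z) (c : E).
Hypotheses (cc : c * c = c) (xc : Rspan x c).

(** A relation, because the generators may be dependent: an endomorphism can have several matrices,
    and a matrix need not come from any endomorphism. *)
Definition represents f (B : 'M[R]_n.+1) : Prop :=
  forall j, f (x j) = \sum_i ract (x i) (B j i)%:A.

Lemma exists_represents f : c * f = f -> exists B, represents f B.
Proof.
move=> cf; have [r rP] := choice (fun j => xc.2 (f (x j))).
exists (\matrix_(j, i) r j i) => j; rewrite -cf endoM rP.
by apply: eq_bigr => i _; rewrite mxE.
Qed.

Lemma represents1 : represents c 1.
Proof.
move=> j; rewrite xc.1 (bigD1 j) //= mxE eqxx scale1r ract1 big1 ?addr0 // => i ij.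
by rewrite mxE eq_sym (negPf ij) scale0r ract0r.
Qed.

Lemma representsB f g A B : represents f A -> represents g B -> represents (f - g) (A - B).
Proof.
move=> fA gB j; rewrite endoB fA gB -sumrB; apply: eq_bigr => i _.
by rewrite !mxE scalerBl ractBr.
Qed.

Lemma representsD f g A B : represents f A -> represents g B -> represents (f + g) (A + B).
Proof.
move=> fA gB j; rewrite endoD fA gB -big_split; apply: eq_bigr => i _.
by rewrite !mxE scalerDl ractDr.
Qed.

Lemma representsZ r f A : represents f A -> represents (r *: f) (r *: A).
Proof.
move=> fA j; rewrite endoZ fA ract_suml; apply: eq_bigr => i _.
by rewrite !mxE ract_algA mulrC.
Qed.

(* Rows of the matrix are images of generators, so composition is reversed. *)
Lemma representsM f g A B : represents f A -> represents g B -> represents (f * g) (B * A).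
Proof.
move=> fA gB j; rewrite endoM gB (rlinear_sum (efunP f)).
under eq_bigr => i _ do rewrite (rlinear_ract (efunP f)) fA ract_suml.
rewrite exchange_big /=; apply: eq_bigr => i _.
rewrite mxE scaler_suml ract_sumr; apply: eq_bigr => k _.
by rewrite ract_algA mulrC.
Qed.

Lemma represents_inj f g B : f * c = f -> g * c = g -> represents f B -> represents g B ->
  f = g.
Proof.
move=> fc gc fB gB; apply: endoP => z; rewrite -fc -gc !endoM.
have [r ->] := xc.2 z; rewrite (rlinear_sum (efunP f)) (rlinear_sum (efunP g)).
by apply: eq_bigr => i _; rewrite (rlinear_ract (efunP f)) (rlinear_ract (efunP g)) fB gB.
Qed.

(** Needed for the adjugate: polynomials in a matrix of [f] do come from endomorphisms, whereas an
    arbitrary matrix computed from it might not. *)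
Lemma represents_horner f B (P : {poly R}) : in_corner c c f -> represents f B ->
  exists g, [/\ in_corner c c g, f * g = g * f & represents g (horner_mx B P)].
Proof.
move=> fc fB; elim/poly_ind: P => [|P a [g [gc fg gP]]].
  exists 0; split; first by split; rewrite ?mulr0 ?mul0r.
    by rewrite mulr0 mul0r.
  by move=> j; rewrite big1 // => i _; rewrite rmorph0 mxE scale0r ract0r.
exists (f * g + a *: c); split.
- apply: in_cornerD; first exact: in_cornerM gc.
  exact/in_cornerZ/in_corner_idem.
- by rewrite mulrDr mulrDl endoZr endoZl fc.1 fc.2 -mulrA fg.
rewrite rmorphD rmorphM /= horner_mx_X horner_mx_C.
apply: representsD; first exact: representsM.
by rewrite -scalemx1; apply/representsZ/represents1.
Qed.

(* Cayley-Hamilton turns a unit determinant into an honest inverse endomorphism,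
   although the generators need not be independent. *)
Lemma represents_adjugate f B : in_corner c c f -> represents f B ->
  exists g, [/\ in_corner c c g, f * g = \det B *: c & g * f = \det B *: c].
Proof.
move=> fc fB; pose chi := char_poly B.
(* Writing [chi] as [P * 'X] plus its constant term, [P] at [B] is the adjugate up to sign, now
   visibly a polynomial in [B]. *)
have : root (chi - (chi.[0])%:P) 0 by rewrite rootE !hornerE subrr.
move=> /factor_theorem [P]; rewrite subr0 => PE.
have [g [gc fg gP]] := represents_horner P fc fB.
have PB : horner_mx B P * B = (- chi.[0])%:M.
  rewrite -{2}[B]horner_mx_X -rmorphM /= -PE rmorphB /= Cayley_Hamilton horner_mx_C sub0r.
  by rewrite rmorphN.
have chi0 : - chi.[0] = - (-1) ^+ n.+1 * \det B.
  by rewrite horner_coef0 char_poly_det mulNr.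
have fgE : f * ((- (-1) ^+ n.+1) *: g) = \det B *: c.
  rewrite endoZr; apply: (@represents_inj _ _ (\det B)%:M).
  - by rewrite endoZl -mulrA gc.2.
  - by rewrite endoZl cc.
  - have -> : (\det B)%:M = (- (-1) ^+ n.+1) *: (horner_mx B P * B).
      by rewrite PB chi0 scale_scalar_mx mulrA mulrNN -expr2 sqrr_sign mul1r.
    exact/representsZ/representsM.
  - by rewrite -scalemx1; apply/representsZ/represents1.
exists ((- (-1) ^+ n.+1) *: g); split => //; first exact: in_cornerZ.
by rewrite endoZl -fg -endoZr.
Qed.

(** Modulo [m], the matrices of endomorphisms of [c Z] form a subalgebra over the residue field,
    which has stable range one. The resulting unit is the reduction of a matrix of [f + y * h]; its
    determinant [d] avoids [m], and the adjugate inverts it up to [d]. *)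
Lemma local_stable_range (m : R -> Prop) f g h s : maximal_ideal m ->
  in_corner c c f -> in_corner c c g -> in_corner c c h ->
  g * f + h = s *: c -> ~ m s ->
  exists y v d, [/\ in_corner c c y, in_corner c c v, (f + y * h) * v = d *: c & ~ m d].
Proof.
move=> mm fc gc hc fgh ms.
have [k [rho [rho0 rhoS]]] := exists_residue_field mm.
pose Sub (M : 'M[k]_n.+1) := exists e B,
  [/\ in_corner c c e, represents e B & M = map_mx rho B].
have [A fA] := exists_represents fc.1; have [B gB] := exists_represents gc.1.
have hE : h = s *: c - g * f by rewrite -fgh addrC addKr.
have hB : represents h (s%:M - A * B).
  rewrite hE; apply: representsB; last exact: representsM.
  by rewrite -scalemx1; apply/representsZ/represents1.
have SubC (a : k) : Sub a%:M.
  have [r <-] := rhoS a; exists (r *: c), r%:M; split.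
  - exact/in_cornerZ/in_corner_idem.
  - by rewrite -scalemx1; apply/representsZ/represents1.
  - by rewrite map_scalar_mx.
have SubM M N : Sub M -> Sub N -> Sub (M * N).
  case=> e [C [ec eC ->]] [e' [C' [ec' eC' ->]]]; exists (e' * e), (C * C'); split.
  - exact: in_cornerM ec.
  - exact: representsM.
  - by rewrite rmorphM.
have SubB M N : Sub M -> Sub N -> Sub (M - N).
  case=> e [C [ec eC ->]] [e' [C' [ec' eC' ->]]]; exists (e - e'), (C - C'); split.
  - exact: in_cornerB.
  - exact: representsB.
  - by rewrite rmorphB.
have s0 : rho s != 0 by apply/eqP => /rho0.
have SA : Sub (map_mx rho A) by exists f, A.
have SB : Sub (map_mx rho B) by exists g, B.
have Sh : Sub (map_mx rho (s%:M - A * B)) by exists h, (s%:M - A * B).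
(* Matrices compose in reverse order, so [a + b * y] here corresponds to [f + y * h]. Division by
   [rho s] normalises the relation to 1. *)
have [|y [Sy yU]] := stable_range (SubC 1) SubB SubM SubC SA (SubM _ _ SB (SubC (rho s)^-1))
  (SubM _ _ Sh (SubC (rho s)^-1)).
  rewrite mulrA -mulrDl rmorphB rmorphM /= addrC subrK map_scalar_mx.
  by rewrite -[_ * _]/(_ *m _) -scalar_mxM divff.
have [e [C [ec eC eE]]] := SubM _ _ (SubC (rho s)^-1) Sy.
have hfB : represents (f + e * h) (A + (s%:M - A * B) * C).
  by apply: representsD => //; apply: representsM.
have fhc : in_corner c c (f + e * h) by apply: in_cornerD => //; apply: in_cornerM hc.
have [v [vc fv _]] := represents_adjugate fhc hfB.
exists e, v, (\det (A + (s%:M - A * B) * C)); split=> //.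
move=> /rho0; apply/eqP; rewrite -det_map_mx rmorphD rmorphM /= -eE mulrA.
by move: yU; rewrite unitmxE unitfE.
Qed.

End Represent.
End Corners.

(** * Local and global splittings *)

Section Splitting.
Variables (R : comNzRingType) (L : algType R) (Z : lmodType L^c).
Local Notation E := (endo Z).
Implicit Types (a b c f g h p q t u v : E) (r s : R) (m : R -> Prop).

(** For [s = 1] this says that [c Z] is isomorphic to a direct summand of [t Z]; a general [s] is
    the cleared denominator of such a splitting after localization. *)
Definition splits t c s : Prop :=
  exists f g, [/\ in_corner t c f, in_corner c t g & g * f = s *: c].

Definition locally_splits t c m : Prop := exists2 s, ~ m s & splits t c s.

Lemma splits_wide t' t c s : t' * t = t -> t * t' = t -> splits t c s -> splits t' c s.
Proof.
move=> t't tt' [f [g [[tf fc] [cg gt] gf]]]; exists f, g; split=> //; split=> //.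
  by rewrite -tf mulrA t't.
by rewrite -gt -mulrA tt'.
Qed.

Lemma locally_splits_wide t' t c m : t' * t = t -> t * t' = t ->
  locally_splits t c m -> locally_splits t' c m.
Proof. by move=> t't tt' [s ms sp]; exists s => //; apply: splits_wide sp. Qed.

(** Evans cancellation of [p] against its copy [q]. Stable range one on [p] modifies [al] so that
    its component from [p] to [q] becomes invertible at [m]; elimination with this pivot then moves
    the image of [c] into [b - q]. *)
Lemma locally_splits_cancel m p c q u v b al be s : maximal_ideal m -> Rfin p ->
  p * p = p -> c * c = c -> p * c = 0 -> c * p = 0 ->
  v * u = p -> u * v = q -> u * p = u -> p * v = v ->
  b * b = b -> b * q = q -> q * b = q ->
  in_corner b (p + c) al -> in_corner (p + c) b be -> be * al = s *: (p + c) -> ~ m s ->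
  locally_splits (b - q) c m.
Proof.
move=> mm [n [x xp]] pp cc pc cp vu uv up pv bb bq qb [bal alpc] [pcbe beb] beal ms.
have qq : q * q = q by rewrite -uv mulrA (mulrKA vu) up.
have qu : q * u = u by rewrite -uv -mulrA vu up.
have bu : b * u = u by rewrite -qu mulrA bq.
set t := b - q.
have tt : t * t = t by exact: idem_sub.
have tu : t * u = 0 by rewrite mulrBl bu qu subrr.
have ppc : p * (p + c) = p by rewrite mulrDr pp pc addr0.
have cpc : c * (p + c) = c by rewrite mulrDr cp cc add0r.
have qtb : q + t = b by rewrite /t addrC subrK.
have tE : t = b - q by [].
clearbody t.
(* The relation fed to stable range is [be * al = s] compressed to [p], with [b] split as [q + t]:
   the part through [q] is the product, the part through [t] is the remainder. *)
have [y [w [d [[py yp] [pw wp] inv md]]]] :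
    exists y w d, [/\ in_corner p p y, in_corner p p w,
      (v * al * p + y * (p * be * t * al * p)) * w = d *: p & ~ m d].
  apply: (local_stable_range (g := p * be * u) (s := s) pp xp mm) => //.
  - by split; rewrite ?mulrA ?pv // -mulrA pp.
  - by split; rewrite ?mulrA ?pp // -mulrA up.
  - by split; rewrite ?mulrA ?pp // -mulrA pp.
  - rewrite !mulrA (mulrKA uv) -2!mulrDl -mulrDr qtb (mulrKA beb) (mulrKA beal).
    by rewrite endoZr endoZl ppc pp.
(* [k] maps [t Z] to [q Z], so [k * k = 0] and [1 + k] is an automorphism with inverse [1 - k]; it
   is applied to the embedding, and its inverse to the retraction. *)
pose k := u * y * be * t.
pose al1 := al + k * al; pose be1 := be - be * k.
have kk : k * k = 0 by rewrite /k !mulrA (mulrKA tu) mulr0 !mul0r.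
have bk : b * k = k by rewrite /k !mulrA bu.
have kp : v * k = y * be * t by rewrite /k !mulrA vu py.
clearbody k.
have beal1 : be1 * al1 = s *: (p + c).
  rewrite /be1 /al1 mulrBl !mulrDr !mulrA (mulrKA kk) mulr0 mul0r addr0.
  by rewrite addrK.
have bal1 : b * al1 = al1 by rewrite /al1 mulrDr mulrA bk bal.
have val1 : v * al1 * w = d *: p.
  rewrite -inv /al1 mulrDr !mulrA kp mulrDl !mulrDl yp -(mulrA _ p w) pw.
  by congr (_ + _); rewrite -(mulrA _ p w) pw.
clearbody al1 be1.
(* Elimination with the pivot [v * al1 * w = d *: p]: [rho] is [d *: al1] without its component in
   [q]. The correction factors through [p], so it disappears after composing with [c * be1]. *)
pose rho := d *: al1 - al1 * w * v * al1.
have vrho : v * rho = 0.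
  by rewrite /rho mulrBr endoZr !mulrA val1 !endoZl pv subrr.
have trho : t * rho = rho.
  by rewrite tE mulrBl -uv -mulrA vrho mulr0 subr0 /rho mulrBr endoZr !mulrA bal1.
exists (d * s); first by case/(maximal_ideal_prime mm).
exists (t * rho * c), (c * be1 * t); split.
- by split; rewrite ?mulrA ?tt // -mulrA cc.
- by split; rewrite ?mulrA ?cc // -mulrA tt.
rewrite !mulrA (mulrKA tt) -(mulrA _ t) trho -(mulrA c) /rho.
rewrite mulrBr endoZr !mulrA beal1.
rewrite scalerA mulrBr mulrBl !(endoZr, endoZl) !mulrA cpc -pw mulrA cp !mul0r scaler0 subr0.
by rewrite cc.
Qed.

(** Each maximal [mf i] differs from [m], as [s] shows, hence is not contained in it; [e] is a
    product of elements of the [mf i] outside [m]. The maximality guard is there because the family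
    given by finite character may have other members. *)
Lemma maximal_ideal_avoid (mf : nat -> R -> Prop) n m s : maximal_ideal m -> m s ->
  (forall i, (i < n)%N -> maximal_ideal (mf i) -> ~ mf i s) ->
  exists e, ~ m e /\ forall i, (i < n)%N -> maximal_ideal (mf i) -> mf i e.
Proof.
move=> mm ms; elim: n => [|n IH] H; first by exists 1; split; first by case: mm.
have [|e [me mfe]] := IH; first by move=> i lt; apply: H; apply: ltnW.
have [mn|nmn] := pselect (maximal_ideal (mf n)); last first.
  exists e; split=> // i; rewrite ltnS leq_eqVlt => /orP[/eqP->|]; first by [].
  exact: mfe.
have [d mnd md] : exists2 d, mf n d & ~ m d.
  apply: contrapT => no.
  have sub x : mf n x -> m x by move=> mx; apply: contrapT => nx; apply: no; exists x.
  have [mI m1 _] := mm; have [_ _ mmax] := mn.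
  case: (mmax _ mI sub) => h; last exact: m1.
  by apply: (H n (ltnSn n) mn); apply/h.
exists (d * e); split; first by case/(maximal_ideal_prime mm).
move=> i; rewrite ltnS leq_eqVlt => /orP[/eqP-> _|lt mi].
  by case: mn => [[_ _ mM] _ _]; rewrite mulrC; apply: mM.
by have := mfe i lt mi; case: mi => [[_ _ mM] _ _]; apply: mM.
Qed.

(** A Chinese remainder argument for maps: a splitting good at the earlier ideals and one good at
    the new ideal are combined with coefficients [s] and [e], where [s * e] lies in all these
    ideals. *)
Lemma semilocally_splits (mf : nat -> R -> Prop) n t c : Rfin c -> c * c = c ->
  (forall i, (i < n)%N -> maximal_ideal (mf i) -> locally_splits t c (mf i)) ->
  exists2 s, splits t c s & forall i, (i < n)%N -> maximal_ideal (mf i) -> ~ mf i s.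
Proof.
move=> [N [x xc]] cc; elim: n => [|n IH] H.
  by exists 0 => //; exists 0, 0; rewrite mulr0 scale0r; do !split; rewrite ?mulr0 ?mul0r.
have [|s [f [g [tf gt gf]]] sP] := IH; first by move=> i lt; apply: H; apply: ltnW.
have [mn|nmn] := pselect (maximal_ideal (mf n)); last first.
  exists s; first by exists f, g.
  by move=> i; rewrite ltnS leq_eqVlt => /orP[/eqP->|]; [| apply: sP].
have [ms|nms] := pselect (mf n s); last first.
  exists s; first by exists f, g.
  by move=> i; rewrite ltnS leq_eqVlt => /orP[/eqP->|]; [| apply: sP].
have [e [ne eP]] := maximal_ideal_avoid mn ms sP.
have [s' ns' [f' [g' [tf' gt' gf']]]] := H n (ltnSn n) mn.
have hc : in_corner c c (g * f' + g' * f) by apply: in_cornerD; apply: in_cornerM; eassumption.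
have [B hB] := exists_represents xc hc.1.
pose d := s ^+ 3 + e ^+ 2 * s'.
(* The cross terms of [G * F] carry the factor [s * e], so modulo each of the ideals [G * F] is the
   scalar [d]. That scalar is [s ^+ 3] at the old ideals and [e ^+ 2 * s'] at the new one, nonzero
   in either case. *)
pose F := s *: f + e *: f'; pose G := s *: g + e *: g'.
have tF : in_corner t c F by apply: in_cornerD; apply: in_cornerZ.
have tG : in_corner c t G by apply: in_cornerD; apply: in_cornerZ.
have GFE : G * F = d *: c + (s * e) *: (g * f' + g' * f).
  have dE : d = s * s * s + e * e * s' by rewrite /d; ring.
  rewrite /G /F mulrDl !mulrDr !endoZl !endoZr !scalerA gf gf' !scalerA [e * s]mulrC.
  by rewrite dE scalerDl scalerDr [_ *: (g' * f) + _]addrC addrACA.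
have GF : in_corner c c (G * F) by apply: in_cornerM tF.
have GFB : represents x (G * F) (d%:M + (s * e) *: B).
  rewrite GFE; apply: representsD; last exact: representsZ.
  by rewrite -scalemx1; apply: representsZ; apply: represents1.
have [psi [psic _ psiE]] := represents_adjugate cc xc GF GFB.
exists (\det (d%:M + (s * e) *: B)).
  exists F, (psi * G); split=> //; first exact: in_cornerM tG.
  by rewrite -mulrA psiE.
move=> i lt mi.
have [k [rho [rho0 _]]] := exists_residue_field mi.
have se0 : rho (s * e) = 0.
  apply/rho0; move: lt; rewrite ltnS leq_eqVlt => /orP[/eqP->|lt].
    by case: mn => [[_ _ mM] _ _]; rewrite mulrC; apply: mM.
  by have := eP i lt mi; case: mi => [[_ _ mM] _ _]; apply: mM.
move/rho0; rewrite -det_map_mx map_mxD map_mxZ se0 scale0r addr0 map_scalar_mx det_scalar.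
apply/eqP; rewrite expf_neq0 //.
move: se0; rewrite /d !expr2 exprSr expr2 !(rmorphD, rmorphM) /= => /eqP; rewrite mulf_eq0.
move: lt; rewrite ltnS leq_eqVlt => /orP[/eqP ein|lt].
  move: mi rho rho0; rewrite ein => _ rho rho0 _.
  have -> : rho s = 0 by apply/rho0.
  have re : rho e != 0 by apply/eqP => /rho0.
  have rs' : rho s' != 0 by apply/eqP => /rho0.
  by rewrite !mul0r add0r !mulf_neq0.
move=> _; have -> : rho e = 0 by apply/rho0/eP.
have rs : rho s != 0 by apply/eqP => /rho0; apply: sP.
by rewrite !mul0r addr0 !mulf_neq0.
Qed.

End Splitting.

(** * From splittings at all maximal ideals to a global splitting *)

Section Gluing.
Variables (R : idomainType) (L : algType R) (Z : lmodType L^c).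
Local Notation E := (endo Z).

(** Fix the map [f1 + f2]. The scalars [z] for which some [g] has [g * (f1 + f2) = z *: c] form an
    ideal; it contains [r] through [g2] and [s] through [g1], and [s] was chosen outside every
    maximal ideal containing [r]. *)
Lemma splits_everywhere (t1 t2 c : E) (r : R) : finite_character R -> Rfin c ->
  c * c = c -> t1 * t1 = t1 -> t2 * t2 = t2 -> t1 * t2 = 0 -> t2 * t1 = 0 ->
  (forall m, maximal_ideal m -> locally_splits t1 c m) ->
  r != 0 -> splits t2 c r -> splits (t1 + t2) c 1.
Proof.
move=> fin cR cc t11 t22 t12 t21 loc rn0 [f2 [g2 [tf2 gt2 gf2]]].
have [n [mf mfP]] := fin r rn0.
have [i _ mi|s [f1 [g1 [tf1 gt1 gf1]]] sP] := semilocally_splits (mf := mf) (n := n) (t := t1) cR cc.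
  exact: loc.
have g1f2 : g1 * f2 = 0 by rewrite -gt1.2 -tf2.1 mulrA (mulrKA t12) mulr0 mul0r.
have g2f1 : g2 * f1 = 0 by rewrite -gt2.2 -tf1.1 mulrA (mulrKA t21) mulr0 mul0r.
have T1 : (t1 + t2) * t1 = t1 by rewrite mulrDl t11 t21 addr0.
have T2 : (t1 + t2) * t2 = t2 by rewrite mulrDl t12 t22 add0r.
have T1' : t1 * (t1 + t2) = t1 by rewrite mulrDr t11 t12 addr0.
have T2' : t2 * (t1 + t2) = t2 by rewrite mulrDr t21 t22 add0r.
have wf : in_corner (t1 + t2) c (f1 + f2).
  by apply: in_cornerD; [apply: in_corner_wide tf1 | apply: in_corner_wide tf2].
pose J (z : R) := exists2 g, in_corner c (t1 + t2) g & g * (f1 + f2) = z *: c.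
have JI : ideal J.
  split.
  - by exists 0; [split; rewrite ?mulr0 ?mul0r | rewrite mul0r scale0r].
  - move=> y z [g gw gE] [h hw hE]; exists (g - h); first exact: in_cornerB.
    by rewrite mulrBl gE hE scalerBl.
  - by move=> y z [g gw gE]; exists (y *: g); [apply: in_cornerZ | rewrite endoZl gE scalerA].
have Jr : J r.
  exists g2; first exact: in_corner_wide gt2.
  by rewrite mulrDr g2f1 add0r.
have Js : J s.
  exists g1; first exact: in_corner_wide gt1.
  by rewrite mulrDr g1f2 addr0.
have [[g gw gE]|J1] := pselect (J 1); first by exists (f1 + f2), g.
have [m mm Jm] := exists_maximal_ideal JI J1.
have [i lt mi] := mfP m mm (Jm _ Jr).
have E : mf i = m by apply/funext => z; apply/propext; split=> h; apply/mi.
by case: (sP i lt); rewrite E //; apply: Jm.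
Qed.

End Gluing.

(** * Functionals and splittings in the tail of a direct sum *)

Section Functionals.
Variables (R : idomainType) (L : algType R) (T : nzRingType) (iota : L -> T).
Hypothesis iotaD : forall a b, iota (a + b) = iota a + iota b.
Hypothesis iotaM : forall a b, iota (a * b) = iota a * iota b.
Hypothesis iota1 : iota 1 = 1.
Hypothesis iota_unit : forall s : R, s != 0 -> exists u : T,
  u * iota s%:A = 1 /\ iota s%:A * u = 1.
Hypothesis iota_eq0 : forall a, iota a = 0 <-> exists2 s : R, s != 0 & s *: a = 0.
Hypothesis iota_frac : forall t : T, exists (a : L) (s : R),
  s != 0 /\ t * iota s%:A = iota a.
Hypotheses (simpT : simple_ring T) (artT : right_artinian T).
Variables (Z : lmodType L^c).
Hypothesis Ztf : tfree Z.
Local Notation E := (endo Z).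
Local Notation iR := (fun s : R => iota s%:A).

Lemma iota0 : iota 0 = 0.
Proof. by apply/iota_eq0; exists 1; rewrite ?oner_neq0 ?scaler0. Qed.

Lemma iotaN a : iota (- a) = - iota a.
Proof. by apply/eqP; rewrite -addr_eq0 -iotaD addNr iota0. Qed.

Lemma iotaB a b : iota (a - b) = iota a - iota b.
Proof. by rewrite iotaD iotaN. Qed.

Lemma iota_sum I (r : seq I) (P : pred I) (F : I -> L) :
  iota (\sum_(i <- r | P i) F i) = \sum_(i <- r | P i) iota (F i).
Proof. exact: (big_morph iota iotaD iota0). Qed.

Lemma iota_algM s r : iota (s * r)%:A = iR s * iR r.
Proof. by rewrite -iotaM mulr_algl scalerA. Qed.

Lemma iota_alg_rreg s (t t' : T) : s != 0 -> t * iR s = t' * iR s -> t = t'.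
Proof.
move=> /iota_unit [u [_ su]] tt'.
by rewrite -[t]mulr1 -[t']mulr1 -su !mulrA tt'.
Qed.

Lemma iota_alg_comm s t : iR s * t = t * iR s.
Proof.
have [a [r [rn0 tr]]] := iota_frac t.
apply: (iota_alg_rreg rn0).
rewrite -[LHS]mulrA tr -iotaM mulr_algl -mulr_algr iotaM -tr -!mulrA -!iota_algM.
by rewrite mulrC.
Qed.

Lemma ract_iota (z : Z) a b : iota a = iota b -> ract z a = ract z b.
Proof.
move=> ab; apply/eqP; rewrite -subr_eq0 -ractBr; apply/eqP.
have /iota_eq0 [s sn0 sab] : iota (a - b) = 0 by rewrite iotaB ab subrr.
by apply: (Ztf (r := s)); [apply/eqP | rewrite ractA mulr_algr sab ract0r].
Qed.

(* A functional on P is a linear map P -> T with values in the image of L, given by lifts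
   to L; these lifts are only linear modulo the R-torsion of L. *)
Definition functional (P : Z -> Prop) (xi : Z -> L) : Prop :=
  (forall x y, P x -> P y -> iota (xi (x + y)) = iota (xi x) + iota (xi y)) /\
  (forall x a, P x -> iota (xi (ract x a)) = iota (xi x) * iota a).

Definition span (x : nat -> Z) (p : nat) (z : Z) : Prop :=
  exists a : nat -> L, z = \sum_(j < p) ract (x j) (a j).

Lemma spanD x p y z : span x p y -> span x p z -> span x p (y + z).
Proof.
move=> [a ->] [b ->]; exists (fun j => a j + b j).
by rewrite -big_split; apply: eq_bigr => i _; rewrite ractDr.
Qed.

Lemma span_ract x p z c : span x p z -> span x p (ract z c).
Proof.
move=> [a ->]; exists (fun j => a j * c); rewrite ract_suml.
by apply: eq_bigr => i _; rewrite ractA.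
Qed.

Lemma spanB x p y z : span x p y -> span x p z -> span x p (y - z).
Proof.
move=> sy sz; apply: spanD => //.
by have := span_ract (- 1) sz; rewrite ractNr ract1.
Qed.

Lemma span0 x p : span x p 0.
Proof. by exists (fun=> 0); rewrite big1 // => i _; rewrite ract0r. Qed.

(** Over the semisimple ring [T] finitely generated modules are projective; [S] clears the
    denominators. The induction adds one generator [X] and splits off the part of it that is
    independent of the previous ones. *)
Lemma dual_basis (x : nat -> Z) p : exists (S : R) (xi : nat -> Z -> L),
  [/\ S != 0, forall j, functional (span x p) (xi j) &
    forall z, span x p z -> ract z S%:A = \sum_(j < p) ract (x j) (xi j z)].
Proof.
elim: p => [|p [S [xi [Sn0 xif xiE]]]].
  exists 1, (fun _ _ => 0); split; first exact: oner_neq0.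
    by move=> j; split=> *; rewrite iota0 ?addr0 ?mul0r.
  by move=> z [a ->]; rewrite !big_ord0 ract0l.
pose X := x p; pose P := span x p.
(* [I] collects the coefficients [t] with [X t] in the span of the earlier generators, up to
   denominators; [k] then projects along [I]. *)
pose I t := exists a s, [/\ s != 0, t * iR s = iota a & P (ract X a)].
have II : right_ideal I.
  split.
  - by exists 0, 1; split; rewrite ?oner_neq0 ?mul0r ?iota0 // ract0r; apply: span0.
  - move=> t t' [a [s [sn0 ts Pa]]] [a' [s' [s'n0 ts' Pa']]].
    exists (a * s'%:A - a' * s%:A), (s * s'); split; first by rewrite mulf_neq0.
      by rewrite mulrBl iotaB !iotaM -ts -ts' [in X in _ - X]mulrC !iota_algM !mulrA.
    by rewrite ractBr -!ractA; apply: spanB; apply: span_ract.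
  - move=> t t' [a [s [sn0 ts Pa]]]; have [b [r [rn0 tr]]] := iota_frac t'.
    exists (a * b), (r * s); split; first by rewrite mulf_neq0.
      by rewrite iota_algM !mulrA -(mulrA t) tr -mulrA -iota_alg_comm mulrA ts iotaM.
    by rewrite -ractA; apply: span_ract.
have [k [[a0 [s0 [s0n0 ks0 Pa0]]] kI]] := right_ideal_complement simpT artT II.
pose l := s0%:A - a0.
have kl : iota l = k * iR s0.
  by rewrite iotaB -ks0 mulrBl mul1r opprB addrC subrK.
have dec z : exists b, span x p.+1 z -> P (z - ract X b).
  have [[a zE]|n] := pselect (span x p.+1 z); last by exists 0 => /n.
  exists (a p) => _; exists a; by rewrite zE big_ord_recr /= addrK.
have [b bP] := choice dec.
(* The coefficient [b z] is an arbitrary choice, unique only modulo [I]; multiplying by [l], which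
   is [k] times [s0] in [T], removes the ambiguity and makes [eta] a functional. *)
pose eta z := l * b z.
have etaE z c : span x p.+1 z -> P (z - ract X c) -> iota (eta z) = iota (l * c).
  move=> sz Pc; rewrite !iotaM kl -!mulrA !iota_alg_comm !mulrA; congr (_ * _).
  apply/eqP; rewrite -subr_eq0 -mulrBr -iotaB; apply/eqP/kI.
  exists (b z - c), 1; split; rewrite ?oner_neq0 // ?scale1r ?iota1 ?mulr1 //.
  have -> : ract X (b z - c) = (z - ract X c) - (z - ract X (b z)).
    by rewrite ractBr opprB [RHS]addrC addrA subrK.
  by apply: spanB => //; apply: bP.
have etaf : functional (span x p.+1) eta.
  split=> [y z sy sz|z c sz].
    rewrite (@etaE _ (b y + b z)) ?mulrDr ?iotaD //; first exact: spanD.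
    by rewrite ractDr opprD addrACA; apply: spanD; apply: bP.
  rewrite (@etaE _ (b z * c)) ?mulrA ?iotaM //; first exact: span_ract.
  by rewrite -ractA -ractBl; apply/span_ract/bP.
pose pi z := ract z s0%:A - ract X (eta z).
have piP z : span x p.+1 z -> P (pi z).
  move=> /bP sz.
  have -> : pi z = ract (z - ract X (b z)) s0%:A + ract (ract X a0) (b z).
    by rewrite /pi /eta /l mulrBl ractBr ractBl !ractA mulr_algl mulr_algr opprB addrA addrAC.
  by apply: spanD; apply: span_ract.
have piD y z : span x p.+1 y -> span x p.+1 z -> pi (y + z) = pi y + pi z.
  move=> sy sz; rewrite /pi (@ract_iota X (eta (y + z)) (eta y + eta z)).
    by rewrite ractDr ractDl opprD addrACA.
  by rewrite etaf.1 ?iotaD.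
have piM z c : span x p.+1 z -> pi (ract z c) = ract (pi z) c.
  move=> sz; rewrite /pi (@ract_iota X (eta (ract z c)) (eta z * c)).
    by rewrite ractBl ract_algC (ractA X).
  by rewrite etaf.2 ?iotaM.
clearbody eta; exists (S * s0), (fun j => if (j < p)%N then xi j \o pi else fun z => eta z * S%:A).
split; first by rewrite mulf_neq0.
  move=> j; case: ltnP => _; split=> [y z sy sz|z c sz] /=.
  - by rewrite piD // (xif j).1 //; apply: piP.
  - by rewrite piM // (xif j).2 //; apply: piP.
  - by rewrite !iotaM etaf.1 // mulrDl.
  - by rewrite !iotaM etaf.2 // -!mulrA iota_alg_comm.
move=> z sz; rewrite big_ord_recr /= ltnn mulrC -ract_algA.
have -> : ract z s0%:A = pi z + ract X (eta z) by rewrite subrK.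
rewrite ractDl xiE; last exact: piP.
by rewrite ractA; congr (_ + _); apply: eq_bigr => i _; rewrite ltn_ord.
Qed.

Definition total (z : Z) : Prop := True.

Lemma rank_one_subproof xi (y : Z) : functional total xi -> rlinear (fun z => ract y (xi z)).
Proof.
move=> [xiD xiM]; split=> [u v|u a].
  by rewrite -ractDr; apply: ract_iota; rewrite iotaD xiD.
by rewrite ractA; apply: ract_iota; rewrite iotaM xiM.
Qed.

Definition rank_one xi y (xif : functional total xi) : E := Endo (rank_one_subproof y xif).

Lemma functional_comp (P : Z -> Prop) xi (c : E) : (forall z, P (c z)) -> functional P xi ->
  functional total (xi \o c).
Proof.
move=> Pc [xiD xiM]; split=> [u v _ _|u a _] /=.
  by rewrite (rlinearD (efunP c)) xiD.
by rewrite (rlinear_ract (efunP c)) xiM.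
Qed.

Definition Lfin (c : E) : Prop := exists p (x : nat -> Z), forall z, span x p (c z).

(** Generators of the trace ideal of [e Z] in [T]: values of functionals, with denominators. Sums
    are left out so that each element stays tied to one functional and one vector. *)
Definition trace_elt (e : E) (t : T) : Prop := exists xi y s,
  [/\ functional total xi, s != 0 & t * iR s = iota (xi (e y))].

Lemma trace_elt_biclosed e t t' : trace_elt e t -> trace_elt e (t * t') /\ trace_elt e (t' * t).
Proof.
move=> [xi [y [s [xif sn0 ts]]]]; have [b [r [rn0 tr]]] := iota_frac t'; split.
  exists xi, (ract y b), (r * s); split; rewrite ?mulf_neq0 //.
  rewrite (rlinear_ract (efunP e)) xif.2 // -ts iota_algM !mulrA -(mulrA t) tr.
  by rewrite -!mulrA iota_alg_comm.
exists (fun z => b * xi z), y, (r * s); split; rewrite ?mulf_neq0 //.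
  by split=> *; rewrite !iotaM ?xif.1 ?xif.2 // ?mulrDr ?mulrA.
by rewrite iota_algM !mulrA -(mulrA t') -(iota_alg_comm r t) mulrA tr -mulrA ts iotaM.
Qed.

(** If all functionals of a dual basis vanished at [e z], then [S] would kill [e z], against
    torsion-freeness. *)
Lemma trace_elt_neq0 e : e * e = e -> Lfin e -> e != 0 -> exists2 t, trace_elt e t & t <> 0.
Proof.
move=> ee [p [x xP]] en0; have [S [xi [Sn0 xif xiE]]] := dual_basis x p.
have [z ezn0] : exists z, e z <> 0.
  by apply: contrapT => no; case/eqP: en0; apply: endoP => z; apply: contrapT => ez; apply: no; exists z.
have [j jn0] : exists j, iota (xi j (e z)) <> 0.
  apply: contrapT => no; apply: ezn0; apply: (Ztf (r := S)); first exact/eqP.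
  rewrite xiE // big1 // => j _; rewrite -[RHS](ract0r (x j)); apply: ract_iota.
  by rewrite iota0; apply: contrapT => jn0; apply: no; exists j.
exists (iota (xi j (e z))) => //; exists (xi j \o e), z, 1; split.
- exact: functional_comp (xif j).
- exact: oner_neq0.
- by rewrite scale1r iota1 mulr1 /= -endoM ee.
Qed.

Lemma trace_elt_common_denominator (e : nat -> E) (u : nat -> T) n :
  (forall i, (i < n)%N -> trace_elt (e i) (u i)) ->
  exists2 s, s != 0 & forall i, (i < n)%N -> exists xi y,
    functional total xi /\ u i * iR s = iota (xi (e i y)).
Proof.
elim: n => [|n IH] H; first by exists 1; rewrite ?oner_neq0.
have [|s sn0 sP] := IH; first by move=> i lt; apply/H/ltnW.
have [xi [y [r [xif rn0 ur]]]] := H n (ltnSn n).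
exists (s * r); first by rewrite mulf_neq0.
move=> i; rewrite ltnS leq_eqVlt => /orP[/eqP->|lt].
  exists xi, (ract y s%:A); split=> //.
  by rewrite mulrC iota_algM mulrA ur (rlinear_ract (efunP _)) xif.2.
have [xi' [y' [xif' us]]] := sP i lt; exists xi', (ract y' r%:A); split=> //.
by rewrite iota_algM mulrA us (rlinear_ract (efunP _)) xif'.2.
Qed.

(** * Factoring through blocks arbitrarily far out *)

Section Tails.
Variable e : nat -> E.
Hypothesis ee : forall i j, e i * e j = if i == j then e i else 0.
Hypothesis en0 : forall i, e i != 0.
Hypothesis efin : forall i, Lfin (e i).

Definition block j j' : E := \sum_(j <= i < j') e i.

Lemma mul_block_r i j j' : e i * block j j' = if (j <= i < j')%N then e i else 0.
Proof.
rewrite /block mulr_sumr; case: ifP => lt.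
  rewrite (bigD1_seq i) ?mem_index_iota ?iota_uniq //= ee eqxx big1 ?addr0 // => k ki.
  by rewrite ee eq_sym (negPf ki).
rewrite big_nat_cond big1 // => k /andP[lt' _]; rewrite ee.
by case: eqP lt' lt => // -> ->.
Qed.

Lemma mul_block_l i j j' : block j j' * e i = if (j <= i < j')%N then e i else 0.
Proof.
rewrite /block mulr_suml; case: ifP => lt.
  rewrite (bigD1_seq i) ?mem_index_iota ?iota_uniq //= ee eqxx big1 ?addr0 // => k ki.
  by rewrite ee (negPf ki).
rewrite big_nat_cond big1 // => k /andP[lt' _]; rewrite ee.
by case: eqP lt' lt => // -> ->.
Qed.

Lemma block_sub j j' k k' : (k <= j)%N -> (j' <= k')%N ->
  block j j' * block k k' = block j j' /\ block k k' * block j j' = block j j'.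
Proof.
move=> kj jk; rewrite {1 3 4 6}/block mulr_suml mulr_sumr; split; apply: eq_big_nat => i /andP[ji ij].
  by rewrite mul_block_r (leq_trans kj ji) (leq_trans ij jk).
by rewrite mul_block_l (leq_trans kj ji) (leq_trans ij jk).
Qed.

Lemma block_disjoint j j' k k' : (j' <= k)%N ->
  block j j' * block k k' = 0 /\ block k k' * block j j' = 0.
Proof.
move=> jk; rewrite {1 4}/block mulr_suml mulr_sumr.
split; rewrite big_nat_cond big1 // => i /andP[/andP[_ ij] _];
  by rewrite (mul_block_r, mul_block_l) [(k <= i)%N]leqNgt (leq_trans ij jk).
Qed.

Lemma blockD j k l : (j <= k)%N -> (k <= l)%N -> block j l = block j k + block k l.
Proof. by move=> jk kl; rewrite /block (big_cat_nat jk kl). Qed.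

(** Write 1 as a sum of trace elements of distinct summands beyond [j]. Since the summands are
    orthogonal, adding up the functionals and the vectors produces no cross terms, and one
    functional takes one vector of the block to a nonzero scalar. *)
Lemma tail_trace j : exists j' xi (y : Z) s, [/\ (j <= j')%N, s != 0, functional total xi,
  block j j' y = y & (forall z, iota (xi (block j j' z)) = iota (xi z)) /\ iota (xi y) = iR s].
Proof.
have [i||n [u [uP u1]]] := @unit_sum_of_biclosed T (fun i => trace_elt (e (j + i))) simpT artT.
- move=> t t'; exact: trace_elt_biclosed.
- by move=> i; apply: trace_elt_neq0 => //; rewrite ee eqxx.
have [s sn0 sP] := trace_elt_common_denominator uP.
have ch i : exists xy : (Z -> L) * Z, (i < n)%N ->
    functional total xy.1 /\ u i * iR s = iota (xy.1 (e (j + i) xy.2)).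
  case: ltnP => [/sP [xi [y h]]|_]; first by exists (xi, y).
  by exists (fun=> 0, 0).
have [xy xyP] := choice ch.
pose xi z := \sum_(i < n) (xy i).1 (e (j + i) z).
pose y := \sum_(i < n) e (j + i) (xy i).2.
have xyf (i : 'I_n) : functional total ((xy i).1 \o e (j + i)).
  by apply: (functional_comp (P := total)) => //; apply: (xyP i (ltn_ord i)).1.
have xif : functional total xi.
  split=> [w z _ _|z a _]; rewrite /xi !iota_sum.
    by rewrite -big_split; apply: eq_bigr => i _; apply: (xyf i).1.
  by rewrite mulr_suml; apply: eq_bigr => i _; apply: (xyf i).2.
have inb (i : 'I_n) : (j <= j + i < j + n)%N by rewrite leq_addr ltn_add2l ltn_ord.
exists (j + n)%N, xi, y, s; split=> //; first exact: leq_addr.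
  rewrite (rlinear_sum (efunP _)); apply: eq_bigr => i _.
  by rewrite -endoM mul_block_l inb.
split=> [z|].
  by rewrite !iota_sum; apply: eq_bigr => i _; rewrite -endoM mul_block_r inb.
rewrite iota_sum -[RHS]mul1r u1 mulr_suml; apply: eq_bigr => i _.
rewrite (xyP i (ltn_ord i)).2; congr (iota (_ _)).
rewrite (rlinear_sum (efunP _)) (bigD1 i) //= -endoM ee eqxx big1 ?addr0 // => k ki.
by rewrite -endoM ee eqn_add2l eq_sym val_eqE (negPf ki).
Qed.

Definition tail_factor (h : E) : Prop := forall j, exists j' f g r,
  [/\ (j <= j')%N, r != 0, block j j' * f = f, g * block j j' = g & g * f = r *: h].

(** With [th w] equal to [s] in the block, [z -> w (xi z)] followed by [z -> y (th z)] is [s] times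
    the given map. *)
Lemma tail_factor_rank_one xi y (xif : functional total xi) : tail_factor (rank_one y xif).
Proof.
move=> j; have [j' [th [w [s [jj' sn0 thf bw [thb thw]]]]]] := tail_trace j.
exists j', (rank_one w xif), (rank_one y thf), s; split=> //.
- by apply: endoP => z; rewrite endoM /= (rlinear_ract (efunP _)) bw.
- by apply: endoP => z; rewrite endoM /=; apply: ract_iota.
apply: endoP => z; rewrite endoM endoZ /= ractA; apply: ract_iota.
by rewrite thf.2 // thw iotaM iota_alg_comm.
Qed.

(** The second factorization is taken beyond the block of the first, so the two do not interact;
    cross-multiplying equalises the scalars. *)
Lemma tail_factorD h1 h2 : tail_factor h1 -> tail_factor h2 -> tail_factor (h1 + h2).
Proof.
move=> t1 t2 j; have [j1 [f1 [g1 [r1 [jj1 r1n0 bf1 gb1 gf1]]]]] := t1 j.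
have [j2 [f2 [g2 [r2 [jj2 r2n0 bf2 gb2 gf2]]]]] := t2 j1.
have [d12 d21] := block_disjoint j j2 (leqnn j1).
have [s1 s1'] := block_sub (leqnn j) jj2; have [s2 s2'] := block_sub jj1 (leqnn j2).
have g1f2 : g1 * f2 = 0 by rewrite -gb1 -bf2 mulrA (mulrKA d12) mulr0 mul0r.
have g2f1 : g2 * f1 = 0 by rewrite -gb2 -bf1 mulrA (mulrKA d21) mulr0 mul0r.
exists j2, (f1 + f2), (r2 *: g1 + r1 *: g2), (r1 * r2); split.
- exact: leq_trans jj2.
- by rewrite mulf_neq0.
- by rewrite mulrDr -bf1 -bf2 !mulrA s1' s2'.
- by rewrite mulrDl !endoZl -gb1 -gb2 -!mulrA s1 s2.
- rewrite mulrDl !mulrDr !endoZl gf1 gf2 g1f2 g2f1 !scaler0 addr0 add0r !scalerA.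
  by rewrite scalerDr mulrC.
Qed.

(** A dual basis of [c Z] writes a multiple of [c] as a sum of rank one maps. *)
Lemma tail_splits c : c * c = c -> Lfin c ->
  forall j, exists j' r, [/\ (j <= j')%N, r != 0 & splits (block j j') c r].
Proof.
move=> cc [p [x xP]] j; have [S [xi [Sn0 xif xiE]]] := dual_basis x p.
have xif' k : functional total (xi k \o c) := functional_comp xP (xif k).
have cE : S *: c = \sum_(k < p) rank_one (x k) (xif' k).
  by apply: endoP => z; rewrite endoZ endo_sum xiE.
have : tail_factor (S *: c).
  rewrite cE; elim/big_ind: _ => [i||k _].
  - by exists i, 0, 0, 1; rewrite oner_neq0 mulr0 !mul0r scaler0.
  - exact: tail_factorD.
  - exact: tail_factor_rank_one.
move=> /(_ j) [j' [f [g [r [jj' rn0 bf gb gf]]]]].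
exists j', (r * S); split; rewrite ?mulf_neq0 //.
exists (f * c), (c * g); split; try by split; rewrite ?mulrA ?bf ?cc // -mulrA ?cc ?gb.
by rewrite mulrA -(mulrA c) gf scalerA endoZr endoZl !cc.
Qed.

End Tails.
End Functionals.

(** * Projections and localizations *)

Section FiniteGeneration.
Variables (R : idomainType) (L : algType R) (Z : lmodType L^c).
Local Notation E := (endo Z).

(* K = all of L gives finite generation over L, K = scalars gives it over R. *)
Definition fg_over (K : L -> Prop) (P : Z -> Prop) : Prop :=
  exists n (x : nat -> Z), forall z, P z -> exists a : nat -> L,
    (forall i, K (a i)) /\ z = \sum_(i < n) ract (x i) (a i).

Lemma fg_over_add K (P Q S : Z -> Prop) : fg_over K P -> fg_over K Q ->
  (forall z, S z -> exists y y', [/\ P y, Q y' & z = y + y']) -> fg_over K S.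
Proof.
move=> [n [x xP]] [n' [x' xQ]] SE.
exists (n + n')%N, (fun i => if (i < n)%N then x i else x' (i - n)%N) => z.
move=> /SE [y [y' [/xP [a [aK ->]] /xQ [a' [a'K ->]] ->]]].
exists (fun i => if (i < n)%N then a i else a' (i - n)%N); split.
  by move=> i; case: ifP.
rewrite big_split_ord /=; congr (_ + _); apply: eq_bigr => i _.
  by rewrite ltn_ord.
by rewrite ltnNge leq_addr /= addKn.
Qed.

Lemma fg_over0 K (P : Z -> Prop) : K 0 -> (forall z, P z -> z = 0) -> fg_over K P.
Proof.
by move=> K0 P0; exists 0%N, (fun=> 0) => z /P0 ->; exists (fun=> 0); rewrite big_ord0.
Qed.

Lemma Lfin_sub (c d : E) : d * c = c -> Lfin d -> Lfin c.
Proof. by move=> dc [p [x xP]]; exists p, x => z; rewrite -dc endoM. Qed.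

Lemma Lfin_sum (e : nat -> E) j j' : (forall i, Lfin (e i)) -> Lfin (block e j j').
Proof.
move=> ef.
have [n [x xP]] : fg_over (fun=> True) (fun z => exists w, z = block e j j' w).
  rewrite /block; elim: (index_iota j j') => [|i s IH].
    by apply: fg_over0 => // z [w ->]; rewrite big_nil.
  apply: (@fg_over_add _ (fun z => exists w, z = e i w)) IH _.
    have [p [x xP]] := ef i; exists p, x => _ [w ->]; have [a ->] := xP w.
    by exists a.
  move=> z [w ->]; exists (e i w), ((\sum_(k <- s) e k) w).
  by rewrite big_cons; split; [exists w | exists w |].
by exists n, x => z; have [|a [_ ->]] := xP (block e j j' z); [exists z | exists a].
Qed.

Lemma Rfin_of_Lfin (c : E) : alg_fin_gen L -> c * c = c -> Lfin c -> Rfin c.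
Proof.
move=> [n [g gP]] cc [p [x xP]].
pose K a := exists r : R, a = r%:A :> L.
have K0 : K 0 by exists 0; rewrite scale0r.
have [N [y yP]] : fg_over K (span x p).
  elim: p {xP} => [|p IH].
    by apply: fg_over0 => // z [a ->]; rewrite big_ord0.
  apply: (@fg_over_add _ (fun z => exists a, z = ract (x p) a) _ _ _ IH).
    exists n, (fun i => ract (x p) (g i)) => _ [a ->]; have [r ->] := gP a.
    exists (fun i => (r i)%:A); split; first by move=> i; exists (r i).
    by rewrite ract_sumr; apply: eq_bigr => i _; rewrite ractA mulr_algr.
  move=> z [a ->]; exists (ract (x p) (a p)), (\sum_(j < p) ract (x j) (a j)).
  by split; [exists (a p) | exists a | rewrite big_ord_recr addrC].
(* A zero generator is appended because [Rspan] expects a nonempty family, as square matrices must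
   form a nonzero ring. *)
exists N, (fun i => if (i < N)%N then c (y i) else 0); split.
  by move=> i; case: ifP => _; rewrite ?(rlinear0 (efunP c)) // -endoM cc.
move=> z; have [a [aK cE]] := yP _ (xP z); have [r rP] := choice aK.
exists (fun i => r i); rewrite big_ord_recr /= ltnn ract0l addr0.
rewrite -{1}cc endoM cE (rlinear_sum (efunP c)); apply: eq_bigr => i _.
by rewrite ltn_ord (rlinear_ract (efunP c)) rP.
Qed.

End FiniteGeneration.

(** * Coordinate projections of an internal direct sum *)

Section Projections.
Variables (R : comNzRingType) (L : algType R) (M : lmodType L^c) (P : nat -> M -> Prop).
Hypothesis Psum : is_direct_sum P.

Let P0 i : P i 0. Proof. by case: Psum => /(_ i) []. Qed.
Let PB i x y : P i x -> P i y -> P i (x - y).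
Proof. by case: Psum => /(_ i) [_ h _] _ _; apply: h. Qed.
Let PD i x y : P i x -> P i y -> P i (x + y).
Proof. by move=> Px Py; rewrite -[y]opprK; apply: (PB) => //; rewrite -sub0r; apply: PB. Qed.
Let PM i x a : P i x -> P i (ract x a).
Proof. by case: Psum => /(_ i) [_ _ h] _ _; apply: h. Qed.

Lemma direct_sum_projections : exists pr : nat -> M -> M,
  [/\ forall i, rlinear (pr i), forall i x, P i (pr i x),
      forall i j x, P j x -> pr i x = if i == j then x else 0 &
      forall x, exists n, x = \sum_(i < n) pr i x].
Proof.
have [_ Pgen Pind] := Psum.
have dec x : exists w : nat -> M, (forall i, P i (w i)) /\
    exists n, (forall i, (n <= i)%N -> w i = 0) /\ x = \sum_(i < n) w i.
  have [n [v [vP ->]]] := Pgen x.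
  exists (fun i => if (i < n)%N then v i else 0); split; first by move=> i; case: ifP.
  exists n; split; first by move=> i; rewrite leqNgt => /negPf ->.
  by apply: eq_bigr => i _; rewrite ltn_ord.
have pad (w : nat -> M) n k : (forall i, (n <= i)%N -> w i = 0) -> (n <= k)%N ->
    \sum_(i < k) w i = \sum_(i < n) w i.
  move=> w0 nk; rewrite -!(big_mkord xpredT w) (big_cat_nat (leq0n n) nk) /=.
  by rewrite [X in _ + X]big_nat_cond [X in _ + X]big1 ?addr0 // => i /andP[/andP[/w0]].
have [pr0 prP] := choice dec; pose pr i x := pr0 x i.
have uniq x w n : (forall i, P i (w i)) -> (forall i, (n <= i)%N -> w i = 0) ->
    x = \sum_(i < n) w i -> forall i, pr i x = w i.
  move=> wP w0 xw i; have [vP [n' [v0 xv]]] := prP x.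
  pose k := (i.+1 + (n + n'))%N.
  apply/eqP; rewrite -subr_eq0; apply/eqP.
  apply: (Pind k (fun i => pr i x - w i) _ _ i); last by rewrite /k addSn ltnS leq_addr.
    by move=> j; apply: PB.
  rewrite sumrB (pad w n k) // ?(pad _ n' k) -?xv -?xw ?subrr //.
    by rewrite /k addnA leq_addl.
  by rewrite /k addnCA leq_addr.
have prE i j x : P j x -> pr i x = if i == j then x else 0.
  move=> Px; apply: (uniq x (fun i => if i == j then x else 0) j.+1).
  - by move=> k; case: eqP => // ->.
  - by move=> k; case: eqP => // ->; rewrite ltnn.
  rewrite big_ord_recr /= eqxx big1 ?add0r // => k _.
  by rewrite ltn_eqF.
exists pr; split=> //.
- move=> i; split=> [x y|x a].
    have [vP [n [v0 xv]]] := prP x; have [vP' [n' [v0' yv]]] := prP y.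
    apply: (uniq _ (fun i => pr i x + pr i y) (n + n')%N).
    + by move=> j; apply: PD.
    + move=> j le; rewrite /pr v0 ?v0' ?addr0 //.
        exact: leq_trans (leq_addl _ _) le.
      exact: leq_trans (leq_addr _ _) le.
    rewrite big_split /= -(pad _ n (n + n')%N v0 (leq_addr _ _)) in xv *.
    by rewrite (pad _ n' _ v0' (leq_addl _ _)) -yv -xv.
  have [vP [n [v0 xv]]] := prP x.
  apply: (uniq _ (fun i => ract (pr i x) a) n).
  + by move=> j; apply: PM.
  + by move=> j le; rewrite /pr v0 // ract0l.
  by rewrite {1}xv ract_suml.
- by move=> i x; case: (prP x).
- by move=> x; have [_ [n [_ xE]]] := prP x; exists n.
Qed.

End Projections.

(** * Lifting maps between localizations *)

Section Transfer.
Variables (R : idomainType) (L : algType R) (m : R -> Prop).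
Hypothesis mm : maximal_ideal m.

Lemma localization_inj (N Nm : lmodType L^c) (psi : N -> Nm) : tfree N ->
  is_localization (fun s => ~ m s) psi -> forall x y, psi x = psi y -> x = y.
Proof.
move=> tf [psil _ ker _] x y xy; apply/eqP; rewrite -subr_eq0; apply/eqP.
have /ker [s ms xs] : psi (x - y) = 0 by rewrite (rlinearB psil) xy subrr.
by apply: tf xs => s0; apply: ms; rewrite s0; case: mm => [[]].
Qed.

(** As [a] has finitely generated image, one denominator [s] serves for all [z]. The lift exists
    elementwise, and it is linear because [psi] is injective on the torsion-free [N]. *)
Lemma localization_lift (M N Mm Nm : lmodType L^c) (phi : M -> Mm) (psi : N -> Nm)
  (F : Mm -> Nm) (a : M -> M) (x : nat -> M) p : tfree N -> rlinear phi ->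
  is_localization (fun s => ~ m s) psi -> rlinear F -> rlinear a ->
  (forall z, span x p (a z)) ->
  exists (h : M -> N) (s : R) (y : nat -> N), [/\ rlinear h, ~ m s,
    forall z, psi (h z) = ract (F (phi (a z))) s%:A & forall z, span y p (h z)].
Proof.
move=> tf phil psiL Fl al ax; have psi_inj := localization_inj tf psiL.
have [psil _ _ frac] := psiL.
have [s [y [ms yP]]] : exists s (y : nat -> N), ~ m s /\
    forall k, (k < p)%N -> ract (F (phi (x k))) s%:A = psi (y k).
  elim: p {ax} => [|p [s [y [ms yP]]]]; first by exists 1, (fun=> 0); split; first by case: mm.
  have [w [r [mr wr]]] := frac (F (phi (x p))).
  exists (s * r), (fun k => if (k < p)%N then ract (y k) r%:A else ract w s%:A); split.
    by case/(maximal_ideal_prime mm).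
  move=> k; rewrite ltnS leq_eqVlt => /orP[/eqP->|lt].
    by rewrite ltnn (rlinear_ract psil) -wr mulrC ract_algA.
  by rewrite lt (rlinear_ract psil) -yP // ract_algA.
have ex z : exists w, psi w = ract (F (phi (a z))) s%:A /\ span y p w.
  have [c ->] := ax z; exists (\sum_(k < p) ract (y k) (c k)); split; last by exists c.
  rewrite (rlinear_sum psil) (rlinear_sum phil) (rlinear_sum Fl) ract_suml.
  apply: eq_bigr => k _.
  by rewrite (rlinear_ract psil) (rlinear_ract phil) (rlinear_ract Fl) -yP // ract_algC.
have [h hP] := choice ex.
exists h, s, y; split=> // [|z|z]; try by case: (hP z).
split=> [z w|z c]; apply: psi_inj.
  rewrite (rlinearD psil) !(hP _).1 (rlinearD al) (rlinearD phil) (rlinearD Fl).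
  exact: ractDl.
by rewrite (rlinear_ract psil) !(hP _).1 (rlinear_ract al) (rlinear_ract phil)
  (rlinear_ract Fl) ract_algC.
Qed.

End Transfer.

(** * Back and forth *)

Section BackAndForth.
Variables (R : idomainType) (L : algType R) (Z : lmodType L^c).
Hypotheses (finR : finite_character R) (Lfg : alg_fin_gen L).
Local Notation E := (endo Z).
Implicit Types (u v f g : E) (e : nat -> E).

Definition orthogonal_family e := forall i j, e i * e j = if i == j then e i else 0.

Definition tail_splitting e := forall c : E, c * c = c -> Lfin c ->
  forall j, exists j' r, [/\ (j <= j')%N, r != 0 & splits (block e j j') c r].

Definition locally_embeds e e' := forall m, maximal_ideal m -> forall l,
  exists j al be s, [/\ ~ m s, in_corner (block e' 0 j) (block e 0 l) al,
    in_corner (block e 0 l) (block e' 0 j) be & be * al = s *: block e 0 l].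

(** [v * u] and [u * v] are idempotents below the first [l] members of each family, and [u], [v] are
    inverse isomorphisms between their images. *)
Definition partial_iso e e' u v l := [/\ in_corner (block e' 0 l) (block e 0 l) u,
  in_corner (block e 0 l) (block e' 0 l) v, u * v * u = u & v * u * v = v].

(** Beyond [u1] restricting to [u], the two-sided conditions make [u1] respect the complements of
    the old domain and range, so that successive differences of domains are again matched. *)
Definition iso_extends u v u1 v1 :=
  [/\ u1 * (v * u) = u, u * v * u1 = u, v * u * v1 = v & v1 * (u * v) = v].

Lemma partial_iso_sym e e' u v l : partial_iso e e' u v l -> partial_iso e' e v u l.
Proof. by case. Qed.

Lemma iso_extends_sym u v u1 v1 : iso_extends u v u1 v1 -> iso_extends v u v1 u1.
Proof. by case. Qed.

Lemma iso_extends_trans u v u1 v1 u2 v2 : u * v * u = u -> v * u * v = v ->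
  iso_extends u v u1 v1 -> iso_extends u1 v1 u2 v2 -> iso_extends u v u2 v2.
Proof.
move=> uvu vuv [a1 a2 a3 a4] [b1 b2 b3 b4].
have p : v1 * u1 * (v * u) = v * u by rewrite -mulrA a1 -[in LHS]uvu mulrA a4.
have q : u1 * v1 * (u * v) = u * v by rewrite -mulrA a4 -[in LHS]vuv mulrA a1.
have p' : v * u * (v1 * u1) = v * u by rewrite mulrA a3 -[in LHS]vuv -!mulrA (mulrA u) a2.
have q' : u * v * (u1 * v1) = u * v by rewrite mulrA a2 -[in LHS]uvu -!mulrA (mulrA v) a3.
split.
- by rewrite -p mulrA b1 a1.
- by rewrite -q' -mulrA b2 a2.
- by rewrite -p' -mulrA b3 a3.
- by rewrite -q mulrA b4 a4.
Qed.

Lemma uniform_bound (P : nat -> nat -> Prop) n :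
  (forall i J J', (J <= J')%N -> P i J -> P i J') ->
  (forall i, (i < n)%N -> exists J, P i J) -> exists J, forall i, (i < n)%N -> P i J.
Proof.
move=> mono; elim: n => [|n IH] H; first by exists 0%N.
have [|J JP] := IH; first by move=> i lt; apply/H/ltnW.
have [J' J'P] := H n (ltnSn n); exists (J + J')%N => i.
rewrite ltnS leq_eqVlt => /orP[/eqP->|lt].
  exact: mono (leq_addl _ _) J'P.
exact: mono (leq_addr _ _) (JP i lt).
Qed.

Lemma partial_iso_forth e e' u v l : orthogonal_family e -> orthogonal_family e' ->
  (forall i, Lfin (e i)) -> tail_splitting e' -> locally_embeds e e' ->
  partial_iso e e' u v l -> exists l1 u1 v1, [/\ (l <= l1)%N,
    partial_iso e e' u1 v1 l1, iso_extends u v u1 v1 & v1 * u1 = block e 0 l].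
Proof.
move=> oe oe' ef tail emb [[bu ub] [bv vb] uvu vuv].
pose b k := block e 0 k; pose b' k := block e' 0 k.
have bsub i j : (i <= j)%N -> b i * b j = b i /\ b j * b i = b i by apply: block_sub.
have bsub' i j : (i <= j)%N -> b' i * b' j = b' i /\ b' j * b' i = b' i by apply: block_sub.
have bb k : b k * b k = b k by case: (bsub k k (leqnn k)).
have bb' k : b' k * b' k = b' k by case: (bsub' k k (leqnn k)).
rewrite -!/(b _) -!/(b' _) in bu ub bv vb *.
pose p := v * u; pose q := u * v; pose c := b l - p.
have pp : p * p = p by rewrite /p mulrA vuv.
have qq : q * q = q by rewrite /q mulrA uvu.
have bp : b l * p = p by rewrite /p mulrA bv.
have pb : p * b l = p by rewrite /p -mulrA ub.
have bq k : (l <= k)%N -> b' k * q = q.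
  by move=> /bsub' [_ h]; rewrite /q -bu !mulrA h.
have qb k : (l <= k)%N -> q * b' k = q.
  by move=> /bsub' [h _]; rewrite /q -vb -!mulrA h.
have pc : p * c = 0 by rewrite mulrBr pb pp subrr.
have cp : c * p = 0 by rewrite mulrBl bp pp subrr.
have cc : c * c = c by apply: idem_sub.
have bc : b l * c = c by rewrite mulrBr bb bp.
have cb : c * b l = c by rewrite mulrBl bb pb.
have pcE : p + c = b l by rewrite addrC subrK.
have up : u * p = u by rewrite mulrA.
have pv : p * v = v by rewrite /p vuv.
have qu : q * u = u by rewrite /q uvu.
have vq : v * q = v by rewrite mulrA.
clearbody c; have blfin : Lfin (b l) by apply: Lfin_sum.
have cfin : Lfin c by apply: Lfin_sub bc blfin.
have cR : Rfin c by apply: Rfin_of_Lfin.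
have pR : Rfin p by apply: Rfin_of_Lfin => //; apply: Lfin_sub bp blfin.
(* At [m], [p + c = b l] splits off some block of [e']; cancelling [p] against [q] leaves [c]. The
   level [J] depends on [m]. *)
have loc m : maximal_ideal m -> exists J, (l <= J)%N /\ locally_splits (b' J - q) c m.
  move=> mm; have [j [al [be [s [ms [bal alb] [bbe beb] beal]]]]] := emb m mm l.
  have [lJ jJ] : (l <= l + j)%N /\ (j <= l + j)%N by rewrite leq_addr leq_addl.
  have [jb1 jb2] := bsub' _ _ jJ.
  exists (l + j)%N; split=> //.
  apply: (locally_splits_cancel (p := p) (u := u) (v := v) (al := al) (be := be) (s := s)) => //.
  - exact: bq.
  - exact: qb.
  - rewrite pcE; split=> //; by rewrite -bal mulrA jb2.
  - rewrite pcE; split=> //; by rewrite -beb -mulrA jb1.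
  - by rewrite pcE.
(* A block beyond [l] is orthogonal to [q] and takes care of every maximal ideal omitting [r0], so a
   common [J] is required only for the finitely many others. *)
have [j0 [r0 [lj0 r0n0 sp0]]] := tail c cc cfin l.
have [n [mf mfP]] := finR r0n0.
have wide J J' : (l <= J)%N -> (J <= J')%N ->
    (b' J' - q) * (b' J - q) = b' J - q /\ (b' J - q) * (b' J' - q) = b' J - q.
  move=> lJ JJ'; have [h1 h2] := bsub' _ _ JJ'; have lJ' := leq_trans lJ JJ'.
  by rewrite !mulrBl !mulrBr h1 h2 !bq ?qb // qq subrr subr0.
have [J JP] := @uniform_bound (fun i J => maximal_ideal (mf i) ->
    (l <= J)%N /\ locally_splits (b' J - q) c (mf i)) n
  (fun i J J' JJ' H mi => let: conj lJ sp := H mi in conj (leq_trans lJ JJ')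
    (locally_splits_wide (wide _ _ lJ JJ').1 (wide _ _ lJ JJ').2 sp))
  (fun i _ => match pselect (maximal_ideal (mf i)) with
    | left mi => let: ex_intro J h := loc _ mi in ex_intro _ J (fun _ => h)
    | right nmi => ex_intro _ 0%N (fun mi => False_ind _ (nmi mi)) end).
pose K := (j0 + J)%N; have j0K : (j0 <= K)%N by apply: leq_addr.
have JK : (J <= K)%N by apply: leq_addl.
have lK := leq_trans lj0 j0K.
have tail_wide j j' : (l <= j)%N -> (j' <= K)%N ->
    (b' K - q) * block e' j j' = block e' j j' /\ block e' j j' * (b' K - q) = block e' j j'.
  move=> lj j'K; have [h1 h2] := block_sub oe' (leq0n j) j'K.
  have [h3 h4] := block_disjoint oe' 0 j' lj.
  have qB : q * block e' j j' = 0 by rewrite -(qb l) // -mulrA h3 mulr0.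
  have Bq : block e' j j' * q = 0 by rewrite -(bq l) // mulrA h4 mul0r.
  by rewrite mulrBl mulrBr h1 h2 qB Bq !subr0.
have locK m : maximal_ideal m -> locally_splits (b' K - q) c m.
  move=> mm; have [mr|nmr] := pselect (m r0); last first.
    have [w1 w2] := tail_wide _ _ (leqnn l) j0K.
    by apply: locally_splits_wide w1 w2 _; exists r0.
  have [i lt mi] := mfP m mm mr.
  have mE : m = mf i by apply/funext => z; apply/propext.
  rewrite mE in mm *; have [lJ sp] := JP i lt mm.
  by have [w1 w2] := wide _ _ lJ JK; apply: locally_splits_wide sp.
(* Gluing needs a second target orthogonal to [b' K - q], hence a block beyond [K]. *)
have [j2 [r2 [Kj2 r2n0 sp2]]] := tail c cc cfin K.
have [d1 d2] := block_disjoint oe' 0 j2 (leqnn K).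
have lj2 := leq_trans lK Kj2.
have [e1 e2] := block_disjoint oe' 0 j2 lK.
have t12 : (b' K - q) * block e' K j2 = 0.
  by rewrite mulrBl d1 -(qb l) // -mulrA e1 mulr0 subrr.
have t21 : block e' K j2 * (b' K - q) = 0.
  by rewrite mulrBr d2 -(bq l) // mulrA e2 mul0r subrr.
have [f [g [[tf fc] [cg gt] gf]]] : splits (b' j2 - q) c 1.
  have -> : b' j2 - q = (b' K - q) + block e' K j2.
    by rewrite /b' (blockD _ (leq0n K) Kj2) addrAC.
  apply: splits_everywhere r2n0 sp2 => //; first by case: (wide _ _ lK (leqnn K)).
  by case: (block_sub oe' (leqnn K) (leqnn j2)).
rewrite scale1r in gf.
have qt : q * (b' j2 - q) = 0 by rewrite mulrBr qb // qq subrr.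
have tq : (b' j2 - q) * q = 0 by rewrite mulrBl bq // qq subrr.
have qf : q * f = 0 by rewrite -tf mulrA qt mul0r.
have gq : g * q = 0 by rewrite -gt -mulrA tq mulr0.
have fp : f * p = 0 by rewrite -fc -mulrA cp mulr0.
have pg : p * g = 0 by rewrite -cg mulrA pc mul0r.
have vf : v * f = 0 by rewrite -vq -mulrA qf mulr0.
have gu : g * u = 0 by rewrite -qu mulrA gq mul0r.
have v1u1 : (v + g) * (u + f) = b l.
  by rewrite mulrDl !mulrDr vf gu gf addr0 add0r pcE.
have fb : f * b l = f by rewrite -fc -mulrA cb.
have bg : b l * g = g by rewrite -cg mulrA bc.
exists j2, (u + f), (v + g); split=> //.
- have [s1 s2] := bsub _ _ lj2; have [s1' s2'] := bsub' _ _ lj2.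
  have bt : b' j2 * (b' j2 - q) = b' j2 - q by rewrite mulrBr bb' bq.
  have tb : (b' j2 - q) * b' j2 = b' j2 - q by rewrite mulrBl bb' qb.
  split.
  + split; first by rewrite mulrDr -{1}bu mulrA s2' bu -{1}tf mulrA bt tf.
    by rewrite mulrDl -{1}ub -mulrA s1 ub -{1}fb -mulrA s1 fb.
  + split; first by rewrite mulrDr -{1}bv mulrA s2 bv -{1}bg mulrA s2 bg.
    by rewrite mulrDl -{1}vb -mulrA s1' vb -{1}gt -mulrA tb gt.
  + by rewrite -mulrA v1u1 mulrDl ub fb.
  + by rewrite v1u1 mulrDr bv bg.
- rewrite -/p -/q; split.
  + by rewrite mulrDl up fp addr0.
  + by rewrite mulrDr qu qf addr0.
  + by rewrite mulrDr pv pg addr0.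
  + by rewrite mulrDl vq gq addr0.
Qed.

(* Going forth and then back makes the new partial isomorphism act as the identity
   on both initial blocks, so that the sequence exhausts both families. *)
Lemma partial_iso_step e e' u v l : orthogonal_family e -> orthogonal_family e' ->
  (forall i, Lfin (e i)) -> (forall i, Lfin (e' i)) ->
  tail_splitting e -> tail_splitting e' -> locally_embeds e e' -> locally_embeds e' e ->
  partial_iso e e' u v l -> exists l1 u1 v1, [/\ (l < l1)%N,
    partial_iso e e' u1 v1 l1, iso_extends u v u1 v1,
    v1 * u1 * block e 0 l = block e 0 l & u1 * v1 * block e' 0 l = block e' 0 l].
Proof.
move=> oe oe' ef ef' te te' em em' uvl.
have [l1 [u1 [v1 [ll1 iso1 ext1 vu1]]]] := partial_iso_forth oe oe' ef te' em uvl.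
have [l2 [v2 [u2 [ll2 iso2 ext2 uv2]]]] :=
  partial_iso_forth oe' oe ef' te em' (partial_iso_sym iso1).
have {}iso2 := partial_iso_sym iso2; have {}ext2 := iso_extends_sym ext2.
have [_ _ uvu vuv] := uvl; have [_ _ uvu1 vuv1] := iso1; have [[u2b u2b'] [v2b v2b'] uvu2 vuv2] := iso2.
(* The successor forces the level to grow even if both halves leave it unchanged; this growth
   exhausts the families. *)
exists l2.+1, u2, v2; split.
- by rewrite ltnS (leq_trans ll1).
- have [s1 s2] := block_sub oe (leqnn 0) (leqnSn l2).
  have [s1' s2'] := block_sub oe' (leqnn 0) (leqnSn l2).
  by split=> //; [apply: in_corner_wide s2' s1 _ | apply: in_corner_wide s2 s1' _].
- exact: iso_extends_trans ext1 ext2.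
- rewrite -vu1; case: ext2 => a1 a2 a3 a4.
  by rewrite -mulrA a1 -[in LHS]uvu1 mulrA a4.
- rewrite uv2; case: (block_sub oe' (leqnn 0) ll1) => _ h; exact: h.
Qed.

(** The chain starts at the zero isomorphism. Stage [n.+1] is the identity on the blocks of stage
    [n], whose level is at least [n]; [n.-1] states this uniformly, with an empty block at 0. *)
Lemma partial_iso_chain e e' : orthogonal_family e -> orthogonal_family e' ->
  (forall i, Lfin (e i)) -> (forall i, Lfin (e' i)) ->
  tail_splitting e -> tail_splitting e' -> locally_embeds e e' -> locally_embeds e' e ->
  exists (l : nat -> nat) (u v : nat -> E), [/\ u 0%N = 0 /\ v 0%N = 0,
    forall n, partial_iso e e' (u n) (v n) (l n),
    forall n, iso_extends (u n) (v n) (u n.+1) (v n.+1),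
    forall n, v n * u n * block e 0 n.-1 = block e 0 n.-1 &
    forall n, u n * v n * block e' 0 n.-1 = block e' 0 n.-1].
Proof.
move=> oe oe' ef ef' te te' em em'.
have iso0 : partial_iso e e' 0 0 0 by do !split; rewrite ?mulr0 ?mul0r.
pose St := {x : E * E * nat | partial_iso e e' x.1.1 x.1.2 x.2}.
have next (x : St) : exists y : St, [/\ ((sval x).2 < (sval y).2)%N,
    iso_extends (sval x).1.1 (sval x).1.2 (sval y).1.1 (sval y).1.2,
    (sval y).1.2 * (sval y).1.1 * block e 0 (sval x).2 = block e 0 (sval x).2 &
    (sval y).1.1 * (sval y).1.2 * block e' 0 (sval x).2 = block e' 0 (sval x).2].
  case: x => [[[u v] l] iso] /=.
  have [l1 [u1 [v1 [ll iso1 ext h h']]]] := partial_iso_step oe oe' ef ef' te te' em em' iso.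
  by exists (exist _ ((u1, v1), l1) iso1).
have [nx nxP] := choice next.
pose st n := iter n nx (exist _ ((0, 0), 0%N) iso0 : St).
have le n : (n <= (sval (st n)).2)%N.
  elim: n => // n IH; have [lt _ _ _] := nxP (st n); exact: leq_ltn_trans IH lt.
exists (fun n => (sval (st n)).2), (fun n => (sval (st n)).1.1), (fun n => (sval (st n)).1.2).
split=> //.
- by move=> n; apply: (svalP (st n)).
- by move=> n; case: (nxP (st n)).
- case=> [|n] /=; first by rewrite /block big_geq ?mulr0.
  have [_ _ h _] := nxP (st n); have [_ s] := block_sub oe (leqnn 0) (le n).
  by rewrite -s mulrA h.
- case=> [|n] /=; first by rewrite /block big_geq ?mulr0.
  have [_ _ _ h] := nxP (st n); have [_ s] := block_sub oe' (leqnn 0) (le n).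
  by rewrite -s mulrA h.
Qed.

End BackAndForth.

(** * From chains of partial isomorphisms to decompositions *)

Lemma tfree_of_torsion_free (R : idomainType) (L : algType R) (A : lmodType L^c) :
  torsion_free A -> tfree A.
Proof.
move=> [Aq [phi [[phil bij _ _] inj]]] x r rn0 xr; apply: inj.
apply: (bij_inj (bij r rn0)).
by rewrite -(rlinear_ract phil) xr (rlinear0 phil) ract0l.
Qed.

Lemma rlinear_comp (R : comNzRingType) (L : algType R) (X Y W : lmodType L^c)
  (f : Y -> W) (g : X -> Y) : rlinear f -> rlinear g -> rlinear (fun x => f (g x)).
Proof. by move=> [fD fM] [gD gM]; split=> *; rewrite ?gD ?gM. Qed.

Lemma rlinear_inv (R : comNzRingType) (L : algType R) (X Y : lmodType L^c)
  (f : X -> Y) (g : Y -> X) : rlinear f -> cancel f g -> cancel g f -> rlinear g.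
Proof.
move=> [fD fM] fK gK; split=> [x y|x a]; apply: (can_inj fK).
  by rewrite fD !gK.
by rewrite fM !gK.
Qed.

Lemma same_genus_sym (R : idomainType) (L : algType R) (M N : lmodType L^c) :
  same_genus M N -> same_genus N M.
Proof.
move=> gen m mm; have [Mm [Nm [phi [psi [F [phiL psiL Fl [G FK GK]]]]]]] := gen m mm.
exists Nm, Mm, psi, phi, G; split=> //; first exact: rlinear_inv Fl FK GK.
by exists F.
Qed.

Section DirectSumTfree.
Variables (R : idomainType) (L : algType R) (M : lmodType L^c).
Variables (A : nat -> lmodType L^c) (eA : forall i, A i -> M).
Hypothesis sumA : is_direct_sum_of eA.

Lemma direct_sum_tfree : (forall i, tfree (A i)) -> tfree M.
Proof.
move=> tfA x r rn0 xr; have [eAl sum] := sumA.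
have [pr [prl prP prE prG]] := direct_sum_projections sum.
have [n ->] := prG x; rewrite big1 // => i _.
have [a aE] := prP i x; have [el einj] := eAl i.
rewrite -aE; have -> : a = 0; last by rewrite (rlinear0 el).
apply: (tfA i) rn0 _; apply: einj.
by rewrite (rlinear_ract el) aE -(rlinear_ract (prl i)) xr (rlinear0 (prl i)) (rlinear0 el).
Qed.

Variables (Z : lmodType L^c) (I : M -> Z) (pi : Z -> M).
Hypotheses (Il : rlinear I) (pil : rlinear pi) (IK : cancel I pi).

Lemma direct_sum_family : (forall i, (exists a : A i, a != 0) /\ mod_fin_gen (A i)) ->
  exists e : nat -> endo Z, [/\ orthogonal_family e, forall i, e i != 0,
    forall i, Lfin (e i), forall j j' z, I (pi (block e j j' z)) = block e j j' z &
    forall x, exists n, block e 0 n (I x) = I x].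
Proof.
move=> Afg; have [eAl sum] := sumA.
have [pr [prl prP prE prG]] := direct_sum_projections sum.
have el i := rlinear_comp Il (rlinear_comp (prl i) pil).
pose e i := Endo (el i).
have eE i z : e i z = I (pr i (pi z)) by [].
have bE j j' z : block e j j' z = \sum_(j <= i < j') e i z by rewrite /block endo_sum.
exists e; split.
- move=> i j; apply: endoP => z; rewrite endoM !eE IK (prE i j) //.
  by case: eqP => [->|_]; rewrite ?(rlinear0 Il).
- move=> i; have [[a an0] _] := Afg i; have [eAil eAinj] := eAl i.
  apply: contraNneq an0 => e0; apply/eqP/eAinj; rewrite (rlinear0 eAil).
  have := congr1 (fun f : endo Z => pi (f (I (eA a)))) e0.
  by rewrite /= !IK (prE i i) ?eqxx ?(rlinear0 pil) //; exists a.
- move=> i; have [_ [n [g gP]]] := Afg i; have [eAil _] := eAl i.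
  exists n, (fun j => I (eA (g j))) => z; rewrite eE; have [a <-] := prP i (pi z).
  have [c ->] := gP a; exists c; rewrite (rlinear_sum eAil) (rlinear_sum Il).
  by apply: eq_bigr => j _; rewrite (rlinear_ract eAil) (rlinear_ract Il).
- move=> j j' z; rewrite bE (rlinear_sum pil) (rlinear_sum Il).
  by apply: eq_bigr => i _; rewrite eE IK.
move=> x; have [n xE] := prG x; exists n; rewrite bE big_mkord {2}xE (rlinear_sum Il).
by apply: eq_bigr => i _; rewrite eE IK.
Qed.

End DirectSumTfree.

(** * The genus hypothesis inside the ambient endomorphism ring *)

Section Ambient.
Variables (R : idomainType) (L : algType R) (M N Z : lmodType L^c).
Variables (I : M -> Z) (pi : Z -> M) (J : N -> Z) (rho : Z -> N).
Hypotheses (Il : rlinear I) (pil : rlinear pi) (IK : cancel I pi).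
Hypotheses (Jl : rlinear J) (rhol : rlinear rho) (JK : cancel J rho).

(** The local isomorphism [F] is lifted on one block up to a denominator. The lift is finitely
    generated, so it lands in a finite block [j] of the other family, on which the inverse [G] is
    lifted in turn. The composite is the product of both denominators, as can be checked in the
    localization, where [M] embeds. *)
Lemma locally_embeds_of_genus (e e' : nat -> endo Z) : tfree M -> tfree N ->
  same_genus M N -> orthogonal_family e -> orthogonal_family e' ->
  (forall i, Lfin (e i)) -> (forall i, Lfin (e' i)) ->
  (forall j j' z, I (pi (block e j j' z)) = block e j j' z) ->
  (forall y, exists n, block e' 0 n (J y) = J y) -> locally_embeds e e'.
Proof.
move=> tfM tfN gen oe oe' ef ef' eI e'J m mm l.
have [Mm [Nm [phi [psi [F [phiL psiL Fl [G FK GK]]]]]]] := gen m mm.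
have Gl := rlinear_inv Fl FK GK.
have [phil _ _ _] := phiL; have [psil _ _ _] := psiL.
have [p [x xP]] := Lfin_sum 0 l ef.
have al := rlinear_comp pil (rlinear_comp (efunP (block e 0 l)) Il).
have [z|h [s [y [hl ms hE hy]]]] := localization_lift (x := pi \o x) (p := p) mm tfN phil psiL Fl al.
  have [c ->] := xP (I z); exists c; rewrite (rlinear_sum pil).
  by apply: eq_bigr => k _; rewrite (rlinear_ract pil).
have [j jP] : exists j, forall k, (k < p)%N -> block e' 0 j (J (y k)) = J (y k).
  apply: (@uniform_bound (fun k j => block e' 0 j (J (y k)) = J (y k)) p).
    move=> k j j' jj' <-; have [_ h'] := block_sub oe' (leqnn 0) jj'.
    by rewrite -endoM h'.
  by move=> k _; apply: e'J.
have hJ z : block e' 0 j (J (h z)) = J (h z).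
  have [c ->] := hy z; rewrite (rlinear_sum Jl) (rlinear_sum (efunP _)).
  by apply: eq_bigr => k _; rewrite (rlinear_ract Jl) (rlinear_ract (efunP _)) jP.
have [p' [x' xP']] := Lfin_sum 0 j ef'.
have bl := rlinear_comp rhol (rlinear_comp (efunP (block e' 0 j)) Jl).
have [z|h' [s' [y' [hl' ms' hE' _]]]] :=
    localization_lift (x := rho \o x') (p := p') mm tfM psil phiL Gl bl.
  have [c ->] := xP' (J z); exists c; rewrite (rlinear_sum rhol).
  by apply: eq_bigr => k _; rewrite (rlinear_ract rhol).
pose al0 := Endo (rlinear_comp Jl (rlinear_comp hl pil)).
pose be0 := Endo (rlinear_comp Il (rlinear_comp hl' rhol)).
have bb : block e 0 l * block e 0 l = block e 0 l by case: (block_sub oe (leqnn 0) (leqnn l)).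
have bb' : block e' 0 j * block e' 0 j = block e' 0 j
  by case: (block_sub oe' (leqnn 0) (leqnn j)).
have bal : block e' 0 j * al0 = al0 by apply: endoP => z; rewrite endoM; apply: hJ.
exists j, (al0 * block e 0 l), (block e 0 l * be0 * block e' 0 j), (s * s'); split.
- by case/(maximal_ideal_prime mm).
- by split; rewrite -?mulrA ?bb // mulrA bal.
- by split; rewrite ?mulrA ?bb // -mulrA bb'.
rewrite -mulrA (mulrA (block e' 0 j)) bal; apply: endoP => z.
set w := block e 0 l z; rewrite !endoM -/w endoZ -/w /= JK.
have -> : h' (h (pi w)) = ract (pi w) (s * s')%:A.
  apply: (localization_inj mm tfM phiL); rewrite hE' hJ JK hE (rlinear_ract Gl) FK.
  rewrite ract_algA (rlinear_ract phil); congr (ract (phi (pi _)) _).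
  by rewrite /w eI -endoM bb.
by rewrite (rlinear_ract Il) (rlinear_ract (efunP _)) /w eI -endoM bb.
Qed.

End Ambient.

(** * Direct sum decomposition from an increasing chain of idempotents *)

Section ChainDecomposition.
Variables (R : idomainType) (L : algType R) (M Z : lmodType L^c).
Variables (I : M -> Z) (pi : Z -> M).
Hypotheses (Il : rlinear I) (pil : rlinear pi) (IK : cancel I pi).
Variable p : nat -> endo Z.
Hypothesis p0 : p 0%N = 0.
Hypothesis pp : forall n, p n * p n = p n.
Hypothesis pS : forall n, p n * p n.+1 = p n /\ p n.+1 * p n = p n.
Hypothesis pI : forall n z, I (pi (p n z)) = p n z.
Hypothesis pex : forall x, exists n, p n (I x) = I x.
Hypothesis pfin : forall n, Lfin (p n).

Definition layer i (x : M) : Prop := (p i.+1 - p i) (I x) = I x.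

Lemma chain_le i k : (i <= k)%N -> p i * p k = p i /\ p k * p i = p i.
Proof.
elim: k => [|k IH]; first by rewrite leqn0 => /eqP->.
rewrite leq_eqVlt => /orP[/eqP->|/IH [h1 h2]]; first by rewrite pp.
have [s1 s2] := pS k; split; first by rewrite -h1 -mulrA s1.
by rewrite -[in LHS]h2 mulrA s2 h2.
Qed.

Lemma layer_idem i : (p i.+1 - p i) * (p i.+1 - p i) = p i.+1 - p i.
Proof. by have [s1 s2] := pS i; apply: idem_sub. Qed.

Lemma layer_orthogonal i k : i != k -> (p i.+1 - p i) * (p k.+1 - p k) = 0.
Proof.
have h a b : (a <= b)%N -> p a * p b = p a by move=> /chain_le [].
have h' a b : (a <= b)%N -> p b * p a = p a by move=> /chain_le [].
rewrite neq_ltn => /orP[] lt; rewrite mulrBl !mulrBr.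
  by rewrite !h ?subrr // ?leqW // ltnW.
by rewrite !h' ?subrr // ?leqW // ltnW.
Qed.

Lemma layerI i z : I (pi ((p i.+1 - p i) z)) = (p i.+1 - p i) z.
Proof. by rewrite endoB (rlinearB pil) (rlinearB Il) !pI. Qed.

Lemma layer_proj i x : layer i (pi ((p i.+1 - p i) (I x))).
Proof. by rewrite /layer layerI -endoM layer_idem. Qed.

Lemma chain_direct_sum : is_direct_sum layer.
Proof.
have Iinj := can_inj IK.
split.
- move=> i; have dl := efunP (p i.+1 - p i); split; rewrite /layer.
  + by rewrite (rlinear0 Il) (rlinear0 dl).
  + by move=> x y hx hy; rewrite (rlinearB Il) (rlinearB dl) hx hy.
  + by move=> x a hx; rewrite (rlinear_ract Il) (rlinear_ract dl) hx.
- move=> x; have [n px] := pex x.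
  exists n, (fun i => pi ((p i.+1 - p i) (I x))); split; first by move=> i; apply: layer_proj.
  rewrite -(rlinear_sum pil) -endo_sum -(big_mkord xpredT (fun i => p i.+1 - p i)).
  by rewrite telescope_sumr // p0 subr0 px IK.
- move=> n v vP v0 i lt; apply: Iinj; rewrite (rlinear0 Il) -(vP i).
  rewrite -[RHS](rlinear0 (efunP (p i.+1 - p i))) -(rlinear0 Il) -v0.
  rewrite (rlinear_sum Il) (rlinear_sum (efunP _)) (bigD1 (Ordinal lt)) //= big1 ?addr0 //.
  move=> k ki; rewrite -(vP k).
  have ik : i != k by rewrite eq_sym; exact: ki.
  exact: (congr1 (fun f : endo Z => f (I (v k))) (layer_orthogonal ik)).
Qed.

Lemma layer_fin_gen i : sub_fin_gen (layer i).
Proof.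
have df : Lfin (p i.+1 - p i).
  have [s1 s2] := pS i; apply: (@Lfin_sub _ _ _ _ (p i.+1)) => //.
  by rewrite mulrBr pp s2.
have [n [g gP]] := df; exists n, (fun j => pi ((p i.+1 - p i) (g j))); split.
  by move=> j _; rewrite /layer layerI -endoM layer_idem.
move=> x xi; have [c cE] := gP (I x); exists c; apply: (can_inj IK).
have -> : I x = (p i.+1 - p i) (\sum_(j < n) ract (g j) (c j)).
  by rewrite -cE -[RHS]/(((p i.+1 - p i) * (p i.+1 - p i)) (I x)) layer_idem.
rewrite (rlinear_sum (efunP _)) (rlinear_sum Il); apply: eq_bigr => j _.
by rewrite (rlinear_ract Il) layerI (rlinear_ract (efunP _)).
Qed.

End ChainDecomposition.

(** * Isomorphic layers and the limit isomorphism *)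

Section ChainIso.
Variables (R : idomainType) (L : algType R) (M N Z : lmodType L^c).
Variables (I : M -> Z) (pi : Z -> M) (J : N -> Z) (rho : Z -> N).
Hypotheses (Il : rlinear I) (pil : rlinear pi) (IK : cancel I pi).
Hypotheses (Jl : rlinear J) (rhol : rlinear rho) (JK : cancel J rho).
Variables u v : nat -> endo Z.
Hypothesis uvu : forall n, u n * v n * u n = u n.
Hypothesis vuv : forall n, v n * u n * v n = v n.
Hypothesis ext : forall n, iso_extends (u n) (v n) (u n.+1) (v n.+1).
Hypothesis vI : forall n z, I (pi (v n z)) = v n z.
Hypothesis uJ : forall n z, J (rho (u n z)) = u n z.
Hypothesis vuI : forall x, exists n, (v n * u n) (I x) = I x.
Hypothesis uvJ : forall y, exists n, (u n * v n) (J y) = J y.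

Lemma chain_domain n : let p := fun k => v k * u k in
  p n * p n.+1 = p n /\ p n.+1 * p n = p n.
Proof.
have [a1 a2 a3 a4] := ext n; rewrite /=; split.
  by rewrite mulrA a3 -[in LHS]vuv -!mulrA (mulrA (u n)) a2.
by rewrite -mulrA a1 -[in LHS]uvu mulrA a4.
Qed.

(** Two-sided extension makes [u i.+1] intertwine the differences of consecutive idempotents ([du]),
    and likewise [v i.+1] ([dv]), so they restrict to inverse maps between the layers. *)
Lemma layer_iso i : sub_iso (layer I (fun k => v k * u k) i) (layer J (fun k => u k * v k) i).
Proof.
have [a1 a2 a3 a4] := ext i; rewrite /layer.
have du : (u i.+1 * v i.+1 - u i * v i) * u i.+1 = u i.+1 * (v i.+1 * u i.+1 - v i * u i).
  by rewrite mulrBl mulrBr uvu mulrA uvu a1 a2.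
have dv : (v i.+1 * u i.+1 - v i * u i) * v i.+1 = v i.+1 * (u i.+1 * v i.+1 - u i * v i).
  by rewrite mulrBl mulrBr vuv mulrA vuv a3 a4.
have pd : v i.+1 * u i.+1 * (v i.+1 * u i.+1 - v i * u i) = v i.+1 * u i.+1 - v i * u i.
  by rewrite mulrBr mulrA vuv (chain_domain i).2.
have qd : u i.+1 * v i.+1 * (u i.+1 * v i.+1 - u i * v i) = u i.+1 * v i.+1 - u i * v i.
  rewrite mulrBr mulrA uvu; congr (_ - _).
  by rewrite -mulrA a4 -[in LHS]vuv mulrA a1.
have vu x : (v i.+1 * u i.+1 - v i * u i) (I x) = I x -> v i.+1 (u i.+1 (I x)) = I x.
  by move=> xi; rewrite -endoM -[in LHS]xi -endoM pd.
exists (fun x => rho (u i.+1 (I x))); split.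
- by move=> x y _ _; rewrite (rlinearD Il) (rlinearD (efunP _)) (rlinearD rhol).
- by move=> x a _; rewrite (rlinear_ract Il) (rlinear_ract (efunP _)) (rlinear_ract rhol).
- by move=> x xi; rewrite uJ -endoM du endoM xi.
- move=> x y xi yi xy; apply: (can_inj IK).
  by rewrite -(vu x xi) -(vu y yi) -(uJ _ (I x)) xy uJ.
- move=> y yi; exists (pi (v i.+1 (J y))).
    by rewrite vI -endoM dv endoM yi.
  by rewrite vI; apply: (can_inj JK); rewrite uJ -endoM -[in LHS]yi -endoM qd.
Qed.

Lemma chain_extends n k : iso_extends (u n) (v n) (u (n + k)%N) (v (n + k)%N).
Proof.
elim: k => [|k IH]; first by rewrite addn0; split; rewrite ?mulrA.
by rewrite addnS; apply: iso_extends_trans IH (ext _).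
Qed.

(** Each element of [M] belongs to the domain of all late [u k], and its image no longer depends on
    [k]. Each identity involves finitely many elements, so it can be checked at one late stage. *)
Lemma chain_limit_iso : mod_iso M N.
Proof.
have [nM nMP] := choice vuI; have [nN nNP] := choice uvJ.
pose f x := rho (u (nM x) (I x)); pose g y := pi (v (nN y) (J y)).
have fE x k : (nM x <= k)%N -> f x = rho (u k (I x)).
  move=> /subnKC <-; have [a1 _ _ _] := chain_extends (nM x) (k - nM x).
  by rewrite -[in RHS](nMP x) -[X in rho X]endoM a1.
have gE y k : (nN y <= k)%N -> g y = pi (v k (J y)).
  move=> /subnKC <-; have [_ _ _ a4] := chain_extends (nN y) (k - nN y).
  by rewrite -[in RHS](nNP y) -[X in pi X]endoM a4.
have vuE x k : (nM x <= k)%N -> v k (u k (I x)) = I x.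
  move=> /subnKC <-; set n := nM x; set k' := (n + _)%N.
  have [a1 _ _ a4] : iso_extends (u n) (v n) (u k') (v k') by apply: chain_extends.
  have E : v k' * u k' * (v n * u n) = v n * u n by rewrite -mulrA a1 -[in LHS]uvu mulrA a4.
  by rewrite -[in RHS](nMP x) -E -[in LHS](nMP x).
have uvE y k : (nN y <= k)%N -> u k (v k (J y)) = J y.
  move=> /subnKC <-; set n := nN y; set k' := (n + _)%N.
  have [a1 _ _ a4] : iso_extends (u n) (v n) (u k') (v k') by apply: chain_extends.
  have E : u k' * v k' * (u n * v n) = u n * v n by rewrite -mulrA a4 -[in LHS]vuv mulrA a1.
  by rewrite -[in RHS](nNP y) -E -[in LHS](nNP y).
exists f; split; first split.
- move=> x y; pose k := (nM (x + y)%R + (nM x + nM y))%N.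
  have k1 : (nM (x + y)%R <= k)%N by rewrite leq_addr.
  have k2 : (nM x <= k)%N by rewrite /k addnCA leq_addr.
  have k3 : (nM y <= k)%N by rewrite /k addnA leq_addl.
  by rewrite !(fE _ k) // (rlinearD Il) (rlinearD (efunP _)) (rlinearD rhol).
- move=> x a; pose k := (nM (ract x a) + nM x)%N.
  have k1 : (nM (ract x a) <= k)%N by rewrite leq_addr.
  have k2 : (nM x <= k)%N by rewrite leq_addl.
  by rewrite !(fE _ k) // (rlinear_ract Il) (rlinear_ract (efunP _)) (rlinear_ract rhol).
- exists g => [x|y].
    pose k := (nM x + nN (f x))%N.
    by rewrite (gE _ k) ?leq_addl // (fE _ k) ?leq_addr // uJ vuE ?leq_addr.
  pose k := (nN y + nM (g y))%N.
  by rewrite (fE _ k) ?leq_addl // (gE _ k) ?leq_addr // vI uvE ?leq_addr.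
Qed.

End ChainIso.

(** * Assembly of the decompositions inside [M * N] *)

Theorem mainTheorem14 (R : idomainType) (L : algType R)
  (M N : lmodType L^c) (A B : nat -> lmodType L^c)
  (eA : forall i, A i -> M) (eB : forall i, B i -> N) :
  finite_character R ->
  alg_fin_gen L ->
  tensorQ_simple_artinian L ->
  is_direct_sum_of eA -> is_direct_sum_of eB ->
  (forall i, (exists a : A i, a != 0) /\ mod_fin_gen (A i) /\ torsion_free (A i)) ->
  (forall i, (exists b : B i, b != 0) /\ mod_fin_gen (B i) /\ torsion_free (B i)) ->
  same_genus M N ->
  (exists (Mi : nat -> M -> Prop) (Ni : nat -> N -> Prop),
     [/\ is_direct_sum Mi, is_direct_sum Ni &
         forall i, [/\ sub_fin_gen (Mi i), sub_fin_gen (Ni i) & sub_iso (Mi i) (Ni i)]])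
  /\ mod_iso M N.
Proof.
move=> finR Lfg [T [iota [[iD iM i1] iU i0 iF [simpT artT]]]] sumA sumB HA HB gen.
have tfM : tfree M.
  by apply: (direct_sum_tfree sumA) => i; have [_ [_ h]] := HA i; apply: tfree_of_torsion_free.
have tfN : tfree N.
  by apply: (direct_sum_tfree sumB) => i; have [_ [_ h]] := HB i; apply: tfree_of_torsion_free.
pose Z : lmodType L^c := (M * N)%type.
have tfZ : tfree Z.
  move=> [x y] r rn0 xy; congr (_, _).
    by apply: (tfM _ r rn0); apply: (congr1 fst xy).
  by apply: (tfN _ r rn0); apply: (congr1 snd xy).
pose I (x : M) : Z := (x, 0); pose J (y : N) : Z := (0, y).
pose pi (z : Z) : M := z.1; pose rho (z : Z) : N := z.2.
have Il : rlinear I.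
  by split=> [x y|x a]; rewrite /I; congr (_, _); rewrite ?addr0 // -[LHS](ract0l N a).
have Jl : rlinear J.
  by split=> [x y|x a]; rewrite /J; congr (_, _); rewrite ?addr0 // -[LHS](ract0l M a).
have pil : rlinear pi by [].
have rhol : rlinear rho by [].
have IK : cancel I pi by [].
have JK : cancel J rho by [].
have [e [oe en0 ef eI eex]] := direct_sum_family sumA Il pil IK
  (fun i => conj (HA i).1 (HA i).2.1).
have [e' [oe' en0' ef' eJ eex']] := direct_sum_family sumB Jl rhol JK
  (fun i => conj (HB i).1 (HB i).2.1).
have te : tail_splitting e.
  by move=> c cc cf; apply: (tail_splits iD iM i1 iU i0 iF simpT artT tfZ oe en0 ef cc cf).
have te' : tail_splitting e'.
  by move=> c cc cf; apply: (tail_splits iD iM i1 iU i0 iF simpT artT tfZ oe' en0' ef' cc cf).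
have em : locally_embeds e e' :=
  locally_embeds_of_genus Il pil Jl rhol JK tfM tfN gen oe oe' ef ef' eI eex'.
have em' : locally_embeds e' e :=
  locally_embeds_of_genus Jl rhol Il pil IK tfN tfM (same_genus_sym gen) oe' oe ef' ef eJ eex.
have [l [u [v [[u0 v0] iso ext pb qb]]]] :=
  partial_iso_chain finR Lfg oe oe' ef ef' te te' em em'.
have uvu n : u n * v n * u n = u n by case: (iso n).
have vuv n : v n * u n * v n = v n by case: (iso n).
have vI n z : I (pi (v n z)) = v n z.
  by have [_ [<- _] _ _] := iso n; rewrite endoM eI.
have uJ n z : J (rho (u n z)) = u n z.
  by have [[<- _] _ _ _] := iso n; rewrite endoM eJ.
have ext' n : iso_extends (v n) (u n) (v n.+1) (u n.+1) := iso_extends_sym (ext n).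
have vuI x : exists n, (v n * u n) (I x) = I x.
  by have [n nx] := eex x; exists n.+1; rewrite -nx -endoM (pb n.+1).
have uvJ y : exists n, (u n * v n) (J y) = J y.
  by have [n ny] := eex' y; exists n.+1; rewrite -ny -endoM (qb n.+1).
have vuf n : Lfin (v n * u n).
  have [_ [bv _] _ _] := iso n.
  by apply: (@Lfin_sub _ _ _ _ (block e 0 (l n))); [rewrite mulrA bv | apply: Lfin_sum].
have uvf n : Lfin (u n * v n).
  have [[bu _] _ _ _] := iso n.
  by apply: (@Lfin_sub _ _ _ _ (block e' 0 (l n))); [rewrite mulrA bu | apply: Lfin_sum].
have vu0 : v 0%N * u 0%N = 0 by rewrite u0 mulr0.
have uv0 : u 0%N * v 0%N = 0 by rewrite u0 mul0r.
have vuvu n : v n * u n * (v n * u n) = v n * u n by rewrite mulrA vuv.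
have uvuv n : u n * v n * (u n * v n) = u n * v n by rewrite mulrA uvu.
have vuS := chain_domain uvu vuv ext.
have uvS := chain_domain vuv uvu ext'.
split; last exact: (chain_limit_iso Il IK rhol JK uvu vuv ext vI uJ vuI uvJ).
exists (layer I (fun k => v k * u k)), (layer J (fun k => u k * v k)); split.
- by apply: (chain_direct_sum Il pil IK vu0 vuvu vuS _ vuI) => n z; apply: vI.
- by apply: (chain_direct_sum Jl rhol JK uv0 uvuv uvS _ uvJ) => n z; apply: uJ.
move=> i; split.
- by apply: (layer_fin_gen Il pil IK vuvu vuS _ vuf) => n z; apply: vI.
- by apply: (layer_fin_gen Jl rhol JK uvuv uvS _ uvf) => n z; apply: uJ.
exact: (layer_iso Il IK rhol JK uvu vuv ext vI uJ).
Qed.
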